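(* Let $k$ be a field, $q\in k$ a primitive $2\ell$-th root of unity, $n\in\mathbb N$ with $2\ell<n$, and $w_1,w_2\notin\mathbb Z$. In $b_n^x=b_n^x(-[2],-[w_1],-[w_2],[w_1+1],[w_2+1],\kappa_{LR})$, let $E$ denote the basis element of the one-dimensional cell module $\mathcal S_n(-n)$ (the half-diagram with $n$ undecorated propagating lines). Then the $k$-linear map $\xi:\mathcal S_n(-n)\to\mathcal S_n(-n+2\ell)$ given by $$E\mapsto\sum_{D}h_3(D)\,D,$$ the sum over the half-diagram basis of $\mathcal S_n(-n+2\ell)$, is a non-zero $b_n^x$-module homomorphism.
   Context: Symplectic blob algebra: generated by $e,e_1,\dots,e_{n-1},f$; relations $e^2=\delta_Le$, $e_i^2=\delta e_i$, $f^2=\delta_Rf$, $e_ie_j=e_je_i$ ($|i-j|\ge2$), $e_1ee_1=\kappa_Le_1$, $e_ie_{i\pm1}e_i=e_i$, $e_{n-1}fe_{n-1}=\kappa_Re_{n-1}$, $IJI=\kappa_{LR}I$, $JIJ=\kappa_{LR}J$ ($I$, $J$ the products of the generators $e_i$ with $i$ odd, resp. even, where $e_0=e$, $e_n=f$), here with $\delta=-[2]$, $\delta_L=-[w_1]$, $\delta_R=-[w_2]$, $\kappa_L=[w_1+1]$, $\kappa_R=[w_2+1]$. Diagrammatically: $e$ = identity with a left blob on line 1, $f$ = identity with a right blob on line $n$, $e_i$ = cup–cap at $i,i+1$; lines may carry a left blob if deformable to the left edge without crossing, a right blob if deformable to the right edge. Quantum numbers: $[x]=\frac{q^x-q^{-x}}{q-q^{-1}}$;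 $Q_i=q^{w_i}\in k^\times$ formal, $[w_i+x]=\frac{Q_iq^x-Q_i^{-1}q^{-x}}{q-q^{-1}}$, and $w_i\notin\mathbb Z$ means $Q_i\notin\pm q^{\mathbb Z}$. $[w]_\ell!=[w][w-1]\cdots[w-\ell+1]$. Cell module $\mathcal S_n(-n+2\ell)$: basis of half-diagrams with $n$ top vertices, $\ell$ non-crossing arcs and $n-2\ell$ undecorated propagating lines; arcs may carry a left blob (if deformable to the left edge) or a right blob (if deformable to the right edge). A generator acts on a half-diagram by stacking on top and straightening (undecorated loop $\to\delta$, loop with left blob $\to\kappa_L$, loop with right blob $\to\kappa_R$, two left blobs on a line $\to\delta_L$ times one, two right blobs $\to\delta_R$ times one), the result being $0$ if the number of unblobbed propagating lines decreases. $\mathcal S_n(-n)$ is one-dimensional with all generators acting by $0$. Hook product: number top vertices $1,\dots,n$ left to right and bottom ends of propagating lines $n+1,\dots,2n-2\ell$ right to left; each line $g=(a,a+2b+1)$, $b\ge0$. $h_3(g)=[b+1]$ for an undecorated arc; $1$ (resp. $-1$) for a propagating line with $a\equiv1,\dots,2\ell$ (resp. $2\ell+1,\dots,4\ell$) mod $4\ell$; $\left[\frac{a+2b+1}{2}\right]\left[\frac{2w_1-a+1}{2}\right]$ for a left-blobbed arc; $\left[\frac{n-a+1}{2}\right]\left[\frac{2w_2-n+a+2b+1}{2}\right]$ for a right-blobbed arc. $h_3(D)=[\ell]!\,[w_1]_\ell!\,[w_2]_\ell!/\prod_{g\in D}h_3(g)$, computed as a rational function in indeterminates $q,Q_1,Q_2$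 with all cancellations performed before specialising. *)

(* Defs.v *)
From HB Require Import structures.
From mathcomp Require Import all_boot all_order all_algebra.
From mathcomp Require Import fraction.
From mathcomp Require Import mpoly.
Set Implicit Arguments. Unset Strict Implicit. Unset Printing Implicit Defensive.
Import Order.TTheory GRing.Theory Num.Theory.
Local Open Scope ring_scope.

(* Decoration of an arc: [None] = undecorated, [Some true] = left blob,
   [Some false] = right blob. *)
Definition blob := option bool.

(* A (candidate) half-diagram on n top vertices, vertex [x : 'I_n] being the
   paper's vertex [x+1].  [d x = None] : a propagating line starts at x;
   [d x = Some (y, b)] : x is joined by an arc to y, the arc carrying the
   decoration b (recorded at both ends). *)
Definition HD (n : nat) := {ffun 'I_n -> option ('I_n * blob)}.

Section HalfDiagrams.
Variable n : nat.
Implicit Types (d : HD n) (x y : 'I_n).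

Definition isarc d x y : bool :=
  if d x is Some (z, _) then z == y else false.

Definition consistent d : bool :=
  [forall x, if d x is Some (y, b) then (y != x) && (d y == Some (x, b))
             else true].

Definition noncrossing d : bool :=
  [forall x : 'I_n, [forall y : 'I_n, [forall x' : 'I_n, [forall y' : 'I_n,
     (isarc d x x' && isarc d y y') ==>
       ~~ [&& (x < y)%N, (y < x')%N & (x' < y')%N]]]]].

Definition prop_not_covered d : bool :=
  [forall x : 'I_n, [forall y : 'I_n, [forall p : 'I_n,
     (isarc d x y && (x < p)%N && (p < y)%N) ==> (d p != None)]]].

Definition covered d x : bool :=
  [exists a : 'I_n, [exists c : 'I_n, isarc d a c && (a < x)%N && (x < c)%N]].

(* the line through x can be deformed to the left (resp. right) edge without
   crossing: it is not under an arc and no propagating line lies to its left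
   (resp. right) *)
Definition lexposed d x : bool :=
  ~~ covered d x && [forall p : 'I_n, (p < x)%N ==> (d p != None)].
Definition rexposed d x : bool :=
  ~~ covered d x && [forall p : 'I_n, (x < p)%N ==> (d p != None)].

Definition blobs_ok d : bool :=
  [forall x, match d x with
             | Some (_, Some true) => lexposed d x
             | Some (_, Some false) => rexposed d x
             | _ => true end].

Definition nprop d : nat := #|[set x | d x == None]|.

(* d is a basis half-diagram of the cell module S_n(-n+2l): l non-crossing
   (possibly blobbed) arcs and n-2l undecorated propagating lines *)
Definition valid (l : nat) d : bool :=
  [&& consistent d, noncrossing d, prop_not_covered d, blobs_ok d
    & nprop d == (n - 2 * l)%N].

Variable k : fieldType.
Variables (dl0 dlL dlR kpL kpR : k).

Definition loop_factor (b : blob) : k :=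
  match b with None => dl0 | Some true => kpL | Some false => kpR end.

(* joining two arc pieces with decorations b1, b2 into a single arc:
   [None] if the result would carry both a left and a right blob (this never
   happens on valid diagrams with propagating lines) *)
Definition join_blobs (b1 b2 : blob) : option (k * blob) :=
  match b1, b2 with
  | None, b | b, None => Some (1, b)
  | Some s1, Some s2 =>
      if s1 == s2 then Some (if s1 then dlL else dlR, Some s1) else None
  end.

(* result of acting by a generator on a basis diagram: [None] means 0,
   [Some (c, d')] means c * d' *)
Definition res := option (k * HD n).

(* e_i, with u = vertex i, v = vertex i+1 (so val v = (val u).+1) *)
Definition act_cup (u v : 'I_n) d : res :=
  let capuv := fun x => if x == u then Some (v, None)
                        else if x == v then Some (u, None) else d x in
  match d u, d v with
  | Some (y, b), _ =>
      if y == v then Some (loop_factor b, [ffun x => capuv x])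
      else match d v with
           | None =>
               if b is None then
                 Some (1, [ffun x => if x == y then None else capuv x])
               else None
           | Some (z, b') =>
               match join_blobs b b' with
               | Some (c, bb) =>
                   Some (c, [ffun x => if x == y then Some (z, bb)
                                       else if x == z then Some (y, bb)
                                       else capuv x])
               | None => None
               end
           end
  | None, Some (z, b') =>
      if b' is None then
        Some (1, [ffun x => if x == z then None else capuv x])
      else None
  | None, None => None  (* two propagating lines are joined *)
  end.

(* e (resp. f): a left (resp. right) blob on the line at vertex p,
   p = vertex 1 (resp. vertex n) *)
Definition act_blob (s : bool) (p : 'I_n) d : res :=
  match d p with
  | None => None  (* blobs a propagating line *)
  | Some (y, None) =>
      Some (1, [ffun x => if x == p then Some (y, Some s)
                          else if x == y then Some (p, Some s) else d x])
  | Some (y, Some s') =>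
      if s' == s then Some (if s then dlL else dlR, d) else None
  end.

(* action of a generator (given by its action on basis diagrams) on a vector
   v = sum_D v(D) D of S_n(-n+2l) (coordinates on the basis of valid
   diagrams); the result is again given by its coordinates *)
Definition act_vec (l : nat) (a : HD n -> res) (v : HD n -> k) : HD n -> k :=
  fun D' => \sum_(D : HD n | valid l D)
     (if a D is Some (c, D'') then (if D'' == D' then c * v D else 0) else 0).

End HalfDiagrams.

Section Hook.
Variable k : fieldType.
Local Notation K := {fraction {mpoly k[3]}}.

Definition qF : K := FracField.tofrac ('X_(0 : 'I_3)).
Definition Q1F : K := FracField.tofrac ('X_(1 : 'I_3)).
Definition Q2F : K := FracField.tofrac ('X_(2 : 'I_3)).

Definition qnum (m : int) : K := (qF ^ m - qF ^ (- m)) / (qF - qF^-1).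
(* [w + m] = (Q q^m - Q^-1 q^-m)/(q - q^-1), with Q = q^w *)
Definition qnumw (Q : K) (m : int) : K :=
  (Q * qF ^ m - Q^-1 * qF ^ (- m)) / (qF - qF^-1).

Definition qfact (l : nat) : K := \prod_(j < l) qnum (j.+1)%:Z.
Definition qfactw (Q : K) (l : nat) : K := \prod_(j < l) qnumw Q (- (j%:Z)).

Variables (n l : nat).

(* h_3(g) for the line g of d starting at vertex x (paper's vertex a = x+1);
   arcs are counted once, at their left end, the right end contributing 1.
   For an arc (a, c), c = a+2b+1. *)
Definition hook_line (d : HD n) (x : 'I_n) : K :=
  let a := (x.+1)%N in
  match d x with
  | None => if ((a.-1 %% (4 * l)) < 2 * l)%N then 1 else -1
  | Some (y, b) =>
      if (x < y)%N then
        let c := (y.+1)%N in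
        match b with
        | None => qnum (((c - a).+1)./2)%:Z                      (* [b+1] *)
        | Some true =>                       (* [(a+2b+1)/2][(2w1-a+1)/2] *)
            qnum (c./2)%:Z * qnumw Q1F (- ((a.-1)./2)%:Z)
        | Some false =>                 (* [(n-a+1)/2][(2w2-n+a+2b+1)/2] *)
            qnum (((n - a).+1)./2)%:Z * qnumw Q2F (- ((n - c)./2)%:Z)
        end
      else 1
  end.

Definition hook3 (d : HD n) : K :=
  qfact l * qfactw Q1F l * qfactw Q2F l / \prod_(x : 'I_n) hook_line d x.

End Hook.

(* Specialisation of a rational function at the point (q, Q1, Q2):
   [spec_at h P c] means that h, after all cancellations, is defined at P
   with value c, i.e. h = N/M with M(P) <> 0 and c = N(P)/M(P). *)
Definition spec_at (k : fieldType) (h : {fraction {mpoly k[3]}})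
    (P : 'I_3 -> k) (c : k) : Prop :=
  exists N M : {mpoly k[3]},
    [/\ M.@[P] != 0,
        h = FracField.tofrac N / FracField.tofrac M
      & c = N.@[P] / M.@[P]].

Definition point3 (k : fieldType) (a b c : k) : 'I_3 -> k :=
  fun i => if val i == 0%N then a else if val i == 1%N then b else c.

(* Main.v *)
Require Import Defs.
From HB Require Import structures.
From mathcomp Require Import all_boot all_order all_algebra.
From mathcomp Require Import fraction.
From mathcomp Require Import mpoly.
From mathcomp Require Import zify ring.
Import Order.TTheory GRing.Theory Num.Theory.
Local Open Scope ring_scope.
Set Implicit Arguments. Unset Strict Implicit. Unset Printing Implicit Defensive.

(** Let [S] be the coefficient of a half-diagram [D'] in [e_i (sum_D h_3(D) D)].
It is computed first over the field of rational functions in [q], [Q1], [Q2].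
If [D'] contains the undecorated arc [(u, u+1)], the diagrams [D] sent by the
cup to [D'] come from reconnecting this arc with an arc or line visible from
it.  Going through the siblings of the cup from right to left, the hook ratios
telescope,
  [[x] / ([m+1] [m+x+1]) = [m+x] / [m+x+1] - [m] / [m+1]],
and the same on the right by reflecting the diagrams.  Together with the closed
loops and the reconnection with a surrounding arc, quantum number identities
show that [S = 0] identically, except when the chain of siblings stops at a
propagating line; then [S] is [h_3(D')] times a sum of terms which are regular
at the root of unity or of the form [([a] + eps) / [a+1]], [eps] a sign.
After specialisation a hook vanishes only if it contains [[l]].  At most one
line of a diagram has such a hook, because it forces the arcs to occupy a
segment of [2l] consecutive vertices; hence [h_3(D)] is regular.  In the
remaining cases for [S] no line of [D'] does, so [h_3(D')] specialises to [0],
and if [a+1 = l] the pole is cancelled because [[l-1] = 1] and the sign rule for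
propagating lines gives [eps = -1]. *)

(** * Half-diagrams and their surgery *)

(** All generators act by [0] on the source, so being a homomorphism means that each generator kills
    the vector of hook values. The obstacle is that hooks may vanish at the root of unity, where the
    ratio of the weights of two neighbouring diagrams then has no meaning. Over rational functions
    every hook is invertible and such a ratio involves only the lines that differ; the price is the
    control of poles afterwards.

    Exact vanishing fails because a propagating line carries a constant sign where an arc carries a
    quantum number, and the telescoping cannot absorb it for generic [q]. The generic sums use of
    these signs only that they are nonzero, which lets them be reflected.

    For [e] and [f] only two diagrams compete, with and without the blob on the arc at the edge. The
    second hook factor of the blobbed arc is [[w]], opposite to the double-blob constant [-[w]], so
    they cancel identically. The map is nonzero because a nest of [l] arcs has exactly one hook
    [[l]], which absorbs the only zero of the numerator. *)

Section Diagrams.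
Variable n : nat.
Implicit Types (d : HD n) (x y z p u v : 'I_n).

(** Propositional form of [valid], with exposure of a blob split into its two obstructions: a
    propagating line on the way to the edge, and an arc above. The count of propagating lines stays
    outside, because each surgery settles it by a separate cardinality argument. *)
Record diagram d : Prop := Diagram {
  diag_sym : forall x y b, d x = Some (y, b) -> y != x /\ d y = Some (x, b);
  diag_nc : forall x x' y y' b b', d x = Some (x', b) -> d y = Some (y', b') ->
    (x < y)%N -> (y < x')%N -> (x' < y')%N -> False;
  diag_np : forall x y b p, d x = Some (y, b) -> (x < p)%N -> (p < y)%N ->
    d p <> None;
  diag_edge : forall x y s p, d x = Some (y, Some s) ->
    (if s then p < x else x < p)%N -> d p <> None;
  diag_unc : forall x y s a c b, d x = Some (y, Some s) ->
    d a = Some (c, b) -> (a < x)%N -> (x < c)%N -> False }.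

Lemma isarcP d x y : reflect (exists b, d x = Some (y, b)) (isarc d x y).
Proof.
rewrite /isarc; case: (d x) => [[z b]|]; last by right => -[].
by apply: (iffP eqP) => [->|[b' [->]]] //; exists b.
Qed.

Lemma coveredPn d x :
  reflect (forall a c b, d a = Some (c, b) -> (a < x)%N -> (x < c)%N -> False)
          (~~ covered d x).
Proof.
apply: (iffP idP) => [/existsPn H a c b dac ax xc|H].
  have /existsPn/(_ c)/negP := H a; apply.
  by rewrite ax xc !andbT; apply/isarcP; exists b.
apply/existsPn => a; apply/existsPn => c; apply/negP => /andP[/andP[]].
by move=> /isarcP[b dac] ax xc; apply: H dac ax xc.
Qed.

Lemma validP l d :
  reflect (diagram d /\ nprop d = (n - 2 * l)%N) (valid l d).
Proof.
apply: (iffP idP) => [|[[Hs Hnc Hnp He Hu] Hn]].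
  case/and5P=> /forallP Hc /forallP Hnc /forallP Hnp /forallP Hb /eqP Hn.
  split=> //; split.
  - by move=> x y b E; have := Hc x; rewrite E => /andP[? /eqP].
  - move=> x x' y y' b b' E E' h1 h2 h3.
    have /forallP/(_ y)/forallP/(_ x')/forallP/(_ y')/implyP H := Hnc x.
    have /H /negP[] : isarc d x x' && isarc d y y'.
      by apply/andP; split; apply/isarcP; [exists b | exists b'].
    by rewrite h1 h2 h3.
  - move=> x y b p E h1 h2.
    have /forallP/(_ y)/forallP/(_ p)/implyP H := Hnp x.
    by apply/eqP; apply: H; rewrite h1 h2 !andbT; apply/isarcP; exists b.
  - move=> x y [] p E h; have := Hb x; rewrite E => /andP[_ /forallP/(_ p)];
      by rewrite h /= => /eqP.
  - move=> x y s a c b E; have := Hb x; rewrite E.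
    by case: s {E} => /andP[/coveredPn H _]; apply: H.
apply/and5P; split; last exact/eqP.
- apply/forallP => x; case E: (d x) => [[y b]|] //.
  by have [-> ->] := Hs _ _ _ E; rewrite eqxx.
- apply/forallP=> x; apply/forallP=> y; apply/forallP=> x'; apply/forallP=> y'.
  apply/implyP => /andP[/isarcP[b E] /isarcP[b' E']]; apply/negP => /and3P[].
  exact: Hnc E E'.
- apply/forallP=> x; apply/forallP=> y; apply/forallP=> p; apply/implyP.
  by move=> /andP[/andP[/isarcP[b E] h1] h2]; apply/eqP; apply: Hnp E h1 h2.
- apply/forallP=> x; case E: (d x) => [[y [[]|]]|] //; apply/andP; split;
    try (by apply/coveredPn => a c b Eac; apply: Hu E Eac);
    by apply/forallP => p; apply/implyP => h; apply/eqP; apply: (He _ _ _ _ E).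
Qed.

(* [splice d u v o o'] replaces what is attached to [u] and [v] by [o] and
   [o'], updating the new partners of [u] and [v]. *)
Definition splice d u v (o o' : option ('I_n * blob)) : HD n :=
  [ffun x => if x == u then o else if x == v then o' else
     let r := if o' is Some (z, b') then
                if x == z then Some (v, b') else d x else d x in
     if o is Some (y, b) then if x == y then Some (u, b) else r else r].

(** [closed_on] fits the vertices beneath an arc, or between the cup and the current place in a
    chain of siblings, where all arcs are undecorated. [closed_dec] admits blobs and suffices for
    parity. *)
Definition closed_on d (i j : nat) := forall x, (i <= x < j)%N ->
  exists2 y, d x = Some (y, None) & (i <= y < j)%N.

Definition closed_dec d (i j : nat) := forall x, (i <= x < j)%N ->
  exists y b, d x = Some (y, b) /\ (i <= y < j)%N.

Lemma diag_inj d x y z b b' : diagram d ->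
  d x = Some (z, b) -> d y = Some (z, b') -> x = y.
Proof.
move=> dg E E'; have [_ F] := diag_sym dg E; have [_] := diag_sym dg E'.
by rewrite F => -[].
Qed.

Lemma diag_neq d x y b : diagram d -> d x = Some (y, b) -> (x : nat) <> y.
Proof.
by move=> dg E h; have [] := diag_sym dg E; rewrite (val_inj h) eqxx.
Qed.

(** [diag_nc] excludes one crossing pattern; reading the second arc from its other end excludes the
    mirror pattern too. *)
Lemma diag_nested d x x' y y' b b' : diagram d ->
  d x = Some (x', b) -> d y = Some (y', b') -> (x < y < x')%N -> (x < y' < x')%N.
Proof.
move=> dg E E' /andP[h1 h2].
have E's := (diag_sym dg E').2; have Es := (diag_sym dg E).2.
have nxy' : (y' : nat) <> x.
  move=> /val_inj h; have := diag_neq dg E; rewrite h in E's.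
  by move: E's; rewrite E => -[] h'; move: h2; rewrite h' ltnn.
have nx'y' : (y' : nat) <> x'.
  move=> /val_inj h; rewrite h in E's; move: E's; rewrite Es => -[] h'.
  by move: h1; rewrite h' ltnn.
have := diag_nc dg E E'; have := diag_nc dg E's E; lia.
Qed.

(** The first vertex of the window is joined to some [y]; the windows under that arc and after it
    are again closed, so induction on the length applies to both. *)
Lemma closed_even d i j : diagram d -> closed_dec d i j -> (i <= j <= n)%N ->
  exists a, j = (i + 2 * a)%N.
Proof.
move=> dg; move: {2}(j - i)%N (leqnn (j - i)) => m.
elim: m i j => [|m IH] i j hm cl hij; first by exists 0%N; lia.
have [->|hlt] : i = j \/ (i < j)%N by lia.
  by exists 0%N; lia.
have hin : (i < n)%N by lia.
pose x := Ordinal hin.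
have [|y [b [E hy]]] := cl x; first by rewrite /= leqnn.
have nxy := diag_neq dg E; rewrite /= in nxy.
have [||| a1 Ha1] := IH i.+1 y; try lia.
  move=> z hz; have [|z' [b' [E' h']]] := cl z; first by lia.
  by exists z', b'; split=> //; have := diag_nested dg E E'; rewrite /=; lia.
have [||| a2 Ha2] := IH y.+1 j; try lia.
  move=> z hz; have [|z' [b' [E' h']]] := cl z; first by lia.
  exists z', b'; split=> //.
  have Es := (diag_sym dg E).2; have E's := (diag_sym dg E').2.
  have := diag_nested dg E E's; rewrite /=.
  have : (z' : nat) <> i.
    move=> h; have hx : z' = x by apply/val_inj.
    by move: E's; rewrite hx E => -[] h2; move: hz; rewrite h2 ltnn.
  have : (z' : nat) <> y.
    move=> /val_inj h; move: E's; rewrite h Es => -[] h2.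
    by move: hz; rewrite -h2 [nat_of_ord x]/=; lia.
  lia.
by exists (a1 + a2).+1; lia.
Qed.

Lemma arc_even d x y b : diagram d -> d x = Some (y, b) -> (x < y)%N ->
  exists a, y = (x + 2 * a).+1 :> nat.
Proof.
move=> dg E h; have [|| a Ha] := @closed_even d x.+1 y dg; last by exists a; lia.
  move=> z hz; case Ez : (d z) => [[z' b']|].
    by exists z', b'; split=> //; have := diag_nested dg E Ez; lia.
  by exfalso; apply: (diag_np dg E _ _ Ez); lia.
by have := ltn_ord y; lia.
Qed.

Lemma covered_undec d x y a c b b' : diagram d ->
  d a = Some (c, b') -> d x = Some (y, b) -> (a < x < c)%N -> b = None.
Proof.
move=> dg Ea Ex /andP[h1 h2]; case: b Ex => // s Ex.
by case: (diag_unc dg Ex Ea h1 h2).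
Qed.

Lemma inside_closed d x y b : diagram d -> d x = Some (y, b) ->
  closed_on d x.+1 y.
Proof.
move=> dg E z hz; case Ez : (d z) => [[z' b']|]; last first.
  by exfalso; apply: (diag_np dg E _ _ Ez); lia.
have hb : b' = None by apply: (covered_undec dg E Ez); lia.
rewrite hb in Ez *.
by exists z' => //; have := diag_nested dg E Ez; lia.
Qed.

End Diagrams.

Section Splices.
Variable n : nat.
Implicit Types (d : HD n) (x y z p u v : 'I_n).

Lemma ord_neq x y : (x : nat) <> y -> (x == y) = false.
Proof. by move=> h; apply/eqP => e; apply: h; rewrite e. Qed.

Lemma splice_u d u v o o' : splice d u v o o' u = o.
Proof. by rewrite ffunE eqxx. Qed.

Lemma splice_v d u v o o' : (u : nat) <> v -> splice d u v o o' v = o'.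
Proof. by move=> h; rewrite ffunE eqxx eq_sym (ord_neq h). Qed.

Lemma splice_l d u v y b o' : (y : nat) <> u -> (y : nat) <> v ->
  splice d u v (Some (y, b)) o' y = Some (u, b).
Proof. by move=> h1 h2; rewrite ffunE (ord_neq h1) (ord_neq h2) eqxx. Qed.

Lemma splice_r d u v y z b b' : (z : nat) <> u -> (z : nat) <> v ->
  (z : nat) <> y ->
  splice d u v (Some (y, b)) (Some (z, b')) z = Some (v, b').
Proof. by move=> h1 h2 h3; rewrite ffunE (ord_neq h1) (ord_neq h2) (ord_neq h3) eqxx. Qed.

Lemma splice_far d u v y z b b' x : (x : nat) <> u -> (x : nat) <> v ->
  (x : nat) <> y -> (x : nat) <> z ->
  splice d u v (Some (y, b)) (Some (z, b')) x = d x.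
Proof. by move=> h1 h2 h3 h4; rewrite ffunE !ord_neq. Qed.

Lemma splice_far1 d u v y b x : (x : nat) <> u -> (x : nat) <> v ->
  (x : nat) <> y -> splice d u v (Some (y, b)) None x = d x.
Proof. by move=> h1 h2 h3; rewrite ffunE !ord_neq. Qed.

(** A splice that joins [u] to [v] again, so only the decoration changes. Diagrams that close a loop
    above [d], and those that a blob generator sends to [d], arise in this way. *)
Definition recolor d u v b := splice d u v (Some (v, b)) (Some (u, b)).

Lemma recolor_id d u v b : diagram d -> d u = Some (v, b) -> recolor d u v b = d.
Proof.
move=> dg E; have [h E'] := diag_sym dg E; apply/ffunP => x; rewrite ffunE.
by case: eqP => [->//|_]; case: eqP => [->//|_].
Qed.

Lemma recolorE d u v b x : diagram d -> (u : nat) <> v ->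
  recolor d u v b x = if x == u then Some (v, b) else
                      if x == v then Some (u, b) else d x.
Proof. by move=> dg h; rewrite ffunE; case: eqP => // h1; case: eqP. Qed.

Lemma recolor_diagram d u v b b' : diagram d -> d u = Some (v, b') ->
  (forall s, b = Some s -> forall p, (if s then (p < u) || (p < v)
                          else (u < p) || (v < p))%N -> d p <> None) ->
  (forall s, b = Some s -> forall a c b'', d a = Some (c, b'') ->
     (a < u < c)%N || (a < v < c)%N -> False) ->
  diagram (recolor d u v b).
Proof.
move=> dg E Hp Hu; have huv := diag_neq dg E; have [_ E'] := diag_sym dg E.
set D := recolor _ _ _ _.
have arcs x x' bx : D x = Some (x', bx) -> exists2 bx', d x = Some (x', bx') &
    bx = bx' \/ (bx = b /\ (x = u \/ x = v)).
  rewrite recolorE //; case: eqP => [->[<- <-]|_]; first by exists b'; auto.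
  by case: eqP => [->[<- <-]|_ ->]; [exists b'|exists bx]; auto.
have none x : D x = None <-> d x = None.
  by rewrite recolorE //; case: eqP => [->|_]; [rewrite E|case: eqP => [->|//]; rewrite E'].
have Du : D u = Some (v, b) by rewrite recolorE // eqxx.
have Dv : D v = Some (u, b) by rewrite recolorE // eqxx ord_neq //; apply: nesym.
split.
- move=> x y bx Ex; have [bx' Ex' _] := arcs _ _ _ Ex.
  have [hx Ey] := diag_sym dg Ex'; split=> //.
  move: Ex; rewrite !recolorE //; case: eqP => [->[<- <-]|hxu].
    by rewrite eqxx ord_neq //; apply: nesym.
  case: eqP => [->[<- <-]|hxv Ex]; first by rewrite eqxx.
  have [_ Ey'] := diag_sym dg Ex.
  case: eqP => [yu|_]; first by move: Ey'; rewrite yu E => -[] /esym.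
  case: eqP => [yv|_] //; by move: Ey'; rewrite yv E' => -[] /esym.
- by move=> x x' y y' bx b'' /arcs[? Ex _] /arcs[? Ey _]; apply: diag_nc Ex Ey.
- move=> x y bx p /arcs[? Ex _] h1 h2 /none; exact: diag_np Ex h1 h2.
- move=> x y s p /arcs[bx Ex]; case=> [h|[h hx]] hs /none.
    by rewrite -h in Ex; apply: diag_edge Ex hs.
  apply: (Hp s) => //; by case: hx hs => ->; case: s {h} => ->; rewrite ?orbT.
- move=> x y s a c b'' /arcs[bx Ex]; case=> [h|[h hx]] /arcs[? Ea _] h1 h2.
    by rewrite -h in Ex; apply: diag_unc Ex Ea h1 h2.
  by apply: (Hu s _ _ _ _ Ea) => //; case: hx h1 h2 => -> -> ->; rewrite ?orbT.
Qed.

Lemma recolor_nprop d u v b b' : diagram d -> d u = Some (v, b') ->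
  nprop (recolor d u v b) = nprop d.
Proof.
move=> dg E; have huv := diag_neq dg E; have [_ E'] := diag_sym dg E.
apply: eq_card => x; rewrite !inE recolorE //; have [->|_] := eqVneq x u.
  by rewrite E.
by have [->|//] := eqVneq x v; rewrite E'.
Qed.

(** * Reconnecting a cup with a sibling arc or with a surrounding arc *)

Section OpenArc.
Variables (d : HD n) (u v y z : 'I_n) (b1 b2 bb : blob).
Hypotheses (dg : diagram d) (huv : v = u.+1 :> nat) (Eu : d u = Some (v, None)).
Hypotheses (Ey : d y = Some (z, bb)) (hyu : (y < u)%N).
Hypothesis hz : ((z < y) || (v < z))%N.
(** The vertices under the two new arcs. One formula serves both geometries: the third range is
    empty for a sibling ([z < y]), the second for a surrounding arc ([v < z]). For a sibling the
    second range contains [y] itself, which is why [nod] has to exempt the ends of the old arc. *)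
Let between (p : nat) := [|| y < p < u, z < p < v | v < p < z]%N.
Hypothesis vis : forall p p' b, d p = Some (p', b) -> (p < p')%N ->
  p <> y -> p <> z -> (p < u < p')%N = (p < y < p')%N.
Hypothesis nop : forall p, between p -> d p <> None.
Hypothesis nod : forall p p' s, between p -> d p = Some (p', Some s) ->
  p = y \/ p = z.
Hypothesis hb1 : forall s, b1 = Some s -> bb = Some s /\ (v < z)%N.
Hypothesis hb2 : forall s, b2 = Some s -> bb = Some s.

Let D := splice d u v (Some (y, b1)) (Some (z, b2)).

Variant open_view x x' (b : blob) : Prop :=
| OpenU of x = u & x' = y & b = b1
| OpenY of x = y & x' = u & b = b1
| OpenV of x = v & x' = z & b = b2
| OpenZ of x = z & x' = v & b = b2
| OpenFar of d x = Some (x', b) & [/\ (x : nat) <> u, (x : nat) <> v,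
    (x : nat) <> y & (x : nat) <> z] & [/\ (x' : nat) <> u, (x' : nat) <> v,
    (x' : nat) <> y & (x' : nat) <> z].

Let Ez : d z = Some (y, bb). Proof. exact: (diag_sym dg Ey).2. Qed.
Let Ev : d v = Some (u, None). Proof. exact: (diag_sym dg Eu).2. Qed.
Let nyz : (y : nat) <> z. Proof. exact: diag_neq dg Ey. Qed.

Lemma open_at : [/\ D u = Some (y, b1), D v = Some (z, b2),
  D y = Some (u, b1) & D z = Some (v, b2)].
Proof.
rewrite splice_u splice_v ?splice_l ?splice_r //; by lia.
Qed.

Lemma openP x x' b : D x = Some (x', b) -> open_view x x' b.
Proof.
have [Du Dv Dy Dz] := open_at.
have [->|nu] := eqVneq x u; first by rewrite Du => -[<- <-]; apply: OpenU.
have [->|nv] := eqVneq x v; first by rewrite Dv => -[<- <-]; apply: OpenV.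
have [->|ny] := eqVneq x y; first by rewrite Dy => -[<- <-]; apply: OpenY.
have [->|nz] := eqVneq x z; first by rewrite Dz => -[<- <-]; apply: OpenZ.
have [nu' nv' ny' nz'] : [/\ (x : nat) <> u, (x : nat) <> v,
    (x : nat) <> y & (x : nat) <> z].
  by split=> /val_inj/eqP; apply/negP.
rewrite splice_far // => E; apply: OpenFar => //.
by split=> /val_inj e; rewrite e in E; have := (diag_sym dg E).2;
   rewrite ?Eu ?Ev ?Ey ?Ez => -[] h; move: nu' nv' ny' nz'; rewrite h.
Qed.

Lemma open_none x : (D x == None) = (d x == None).
Proof.
have [Du Dv Dy Dz] := open_at.
have [->|nu] := eqVneq x u; first by rewrite Du Eu.
have [->|nv] := eqVneq x v; first by rewrite Dv Ev.
have [->|ny] := eqVneq x y; first by rewrite Dy Ey.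
have [->|nz] := eqVneq x z; first by rewrite Dz Ez.
by rewrite splice_far //; move=> /val_inj/eqP; apply/negP.
Qed.

Lemma open_nprop : nprop D = nprop d.
Proof. by apply: eq_card => x; rewrite !inE open_none. Qed.

Let D_none p : D p = None -> d p = None.
Proof. by move/eqP; rewrite open_none => /eqP. Qed.

(** [vis] only treats arcs read from their left end, and only [u] and [y]. As [u], [v] are
    neighbours and the old arc [(y, z)] crosses nothing, the same holds for [v] and [z] and for both
    orientations. *)
Let vis2 p p' b : d p = Some (p', b) -> [/\ (p : nat) <> u, (p : nat) <> v,
    (p : nat) <> y & (p : nat) <> z] -> [/\ (p' : nat) <> u, (p' : nat) <> v,
    (p' : nat) <> y & (p' : nat) <> z] ->
  [/\ (p < u < p')%N = (p < y < p')%N, (p < v < p')%N = (p < z < p')%N,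
      (p' < u < p)%N = (p' < y < p)%N & (p' < v < p)%N = (p' < z < p)%N].
Proof.
move=> E [h1 h2 h3 h4] [h5 h6 h7 h8]; have E' := (diag_sym dg E).2.
have H1 := diag_nested dg E Ey; have H2 := diag_nested dg E Ez.
have H3 := diag_nested dg E' Ey; have H4 := diag_nested dg E' Ez.
have := diag_neq dg E; case: (ltnP p p') => hpp' hne.
  have H5 : (p < u < p')%N = (p < y < p')%N.
    by apply: vis E _ _ _ => // e; [rewrite e in h3|rewrite e in h4].
  clear - h1 h2 h3 h4 h5 h6 h7 h8 H1 H2 H3 H4 H5 hpp' huv; split; lia.
have hp : (p' < p)%N by lia.
have H5 : (p' < u < p)%N = (p' < y < p)%N.
  by apply: vis E' _ _ _ => // e; [rewrite e in h7|rewrite e in h8].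
clear - h1 h2 h3 h4 h5 h6 h7 h8 H1 H2 H3 H4 H5 hp huv; split; lia.
Qed.

(** The two ends of a new arc lie under the same untouched arcs, so nothing is crossed. A blob on a
    new arc is inherited from [(y, z)], together with its exposure; [hb1] reflects that in the
    sibling case [(y, u)] lies beneath [(z, v)] and must be undecorated. *)
Lemma open_diagram : diagram D.
Proof.
have [Du Dv Dy Dz] := open_at.
split.
- move=> x x' b; case/openP=> [->->->|->->->|->->->|->->->|E hx hx'].
  1-4: split=> //; apply/eqP=> e; move: hyu hz huv nyz; rewrite -?e; lia.
  case: hx' => *; rewrite splice_far //; exact: diag_sym E.
- move=> x x' w w' b b' /openP V1 /openP V2.
  case: V1 => [->->_|->->_|->->_|->->_|E hx hx'];
  case: V2 => [->->_|->->_|->->_|->->_|E' hw hw']; try lia.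
  all: try (by have [] := vis2 E' hw hw'; lia).
  all: try (by have [] := vis2 E hx hx'; lia).
  exact: diag_nc E E'.
- move=> x x' b p /openP V h1 h2 /D_none hp.
  case: V h1 h2 => [->->_|->->_|->->_|->->_|E hx hx'] h1 h2.
  1-4: by apply: (nop _ hp); rewrite /between; lia.
  exact: diag_np E h1 h2 hp.
- move=> x x' s p /openP V h /D_none hp.
  have npv : (p : nat) <> v by move=> /val_inj e; rewrite e Ev in hp.
  have npu : (p : nat) <> u by move=> /val_inj e; rewrite e Eu in hp.
  have npy : (p : nat) <> y by move=> /val_inj e; rewrite e Ey in hp.
  have npz : (p : nat) <> z by move=> /val_inj e; rewrite e Ez in hp.
  have key : bb = Some s ->
      (if s then (p < y) || (p < z) else (y < p) || (z < p))%N -> False.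
    move=> eb hs; have Ey' := Ey; have Ez' := Ez; rewrite eb in Ey' Ez'.
    have [hh|hh] : (if s then p < y else y < p)%N \/ (if s then p < z else z < p)%N.
      by case: (s) hs => /orP.
    - exact: diag_edge Ey' hh hp.
    - exact: diag_edge Ez' hh hp.
  have nb : ~~ between p by apply/negP => /nop.
  case: V h => [->_ e|->_ e|->_ e|->_ e|E hx hx'] h.
  5: exact: diag_edge E h hp.
  1-2: have [e1 e2] := hb1 (esym e).
  3-4: have e1 := hb2 (esym e).
  1-4: apply: (key e1); move: nb; rewrite /between; case: (s) h => h; lia.
- move=> x x' s a c b /openP V /openP W h1 h2.
  have key : bb = Some s -> d a = Some (c, b) ->
      ~~ (a < y < c)%N /\ ~~ (a < z < c)%N.
    move=> eb Ea; have Ey' := Ey; have Ez' := Ez; rewrite eb in Ey' Ez'.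
    by split; apply/negP => /andP[]; [apply: diag_unc Ey' Ea|apply: diag_unc Ez' Ea].
  case: V h1 h2 => [->_ e|->_ e|->_ e|->_ e|E [? ? ? ?] hx'] h1 h2.
  5: { have nod' : between x -> False.
         by move=> /nod/(_ E)[] e; subst x.
       case: W h1 h2 => [->->_|->->_|->->_|->->_|E' ha hc] h1 h2;
         [..|exact: diag_unc E E' h1 h2]; apply: nod'; rewrite /between; lia. }
  1-2: have [e1 e2] := hb1 (esym e).
  3-4: have e1 := hb2 (esym e).
  all: case: W h1 h2 => [->->_|->->_|->->_|->->_|E' ha hc] h1 h2; try lia.
  all: have [] := vis2 E' ha hc; have := key e1 E'; lia.
Qed.

End OpenArc.

End Splices.

(** * Reconnecting a cup with a propagating line on its left *)

Section OpenPropagating.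
Variable n : nat.
Variables (d : HD n) (u v y : 'I_n).
Hypotheses (dg : diagram d) (huv : v = u.+1 :> nat) (Eu : d u = Some (v, None)).
Hypotheses (Ey : d y = None) (hyu : (y < u)%N) (cl : closed_on d y.+1 u).

Let D := splice d u v (Some (y, None)) None.

Let Ev : d v = Some (u, None). Proof. exact: (diag_sym dg Eu).2. Qed.

Lemma cup_uncovered_prop a c b : d a = Some (c, b) -> (a < u < c)%N -> False.
Proof.
move=> E h; have ay : (a : nat) <> y by move=> /val_inj e; rewrite e Ey in E.
have [ha|ha] : (a < y)%N \/ (y < a)%N by lia.
  by apply: (diag_np dg E _ _ Ey); lia.
have [|c' E' h'] := cl (x := a); first by lia.
by move: h h'; rewrite E in E'; case: E' => ->; lia.
Qed.

Lemma open_prop_at : [/\ D u = Some (y, None), D v = None & D y = Some (u, None)].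
Proof. by rewrite splice_u splice_v ?splice_l //; lia. Qed.

Lemma open_propP x x' b : D x = Some (x', b) ->
  [\/ [/\ x = u, x' = y & b = None], [/\ x = y, x' = u & b = None] |
   [/\ d x = Some (x', b), [/\ (x : nat) <> u, (x : nat) <> v & (x : nat) <> y]
     & [/\ (x' : nat) <> u, (x' : nat) <> v & (x' : nat) <> y]]].
Proof.
have [Du Dv Dy] := open_prop_at.
have [->|nu] := eqVneq x u; first by rewrite Du => -[<- <-]; constructor 1.
have [->|nv] := eqVneq x v; first by rewrite Dv.
have [->|ny] := eqVneq x y; first by rewrite Dy => -[<- <-]; constructor 2.
have [nu' nv' ny'] : [/\ (x : nat) <> u, (x : nat) <> v & (x : nat) <> y].
  by split=> /val_inj/eqP; apply/negP.
rewrite splice_far1 // => E; constructor 3; split=> //.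
by split=> /val_inj e; rewrite e in E; have := (diag_sym dg E).2;
   rewrite ?Eu ?Ev ?Ey // => -[] h; move: nu' nv'; rewrite h.
Qed.

Lemma open_prop_none x : (D x == None) = (x == v) || (x != y) && (d x == None).
Proof.
have [Du Dv Dy] := open_prop_at.
have [->|nv] := eqVneq x v; first by rewrite Dv.
have [->|ny] := eqVneq x y; first by rewrite Dy.
have [->|nu] := eqVneq x u; first by rewrite Du Eu.
by rewrite splice_far1 //; move=> /val_inj/eqP; apply/negP.
Qed.

Lemma open_prop_nprop : nprop D = nprop d.
Proof.
have -> : nprop D = #|v |: ([set x | d x == None] :\ y)|.
  by apply: eq_card => x; rewrite !inE open_prop_none.
rewrite cardsU1 /nprop [in RHS](cardsD1 y) !inE Ev andbF Ey eqxx /=.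
by rewrite addnC.
Qed.

(** The cup and the line at [y] are both uncovered, so the new arc [(y, u)] crosses nothing. The
    line merely moves from [y] to [v], past vertices matched by undecorated arcs. *)
Lemma open_prop_diagram : diagram D.
Proof.
have [Du Dv Dy] := open_prop_at.
have Dn p : D p = None -> p = v \/ d p = None /\ (p : nat) <> y.
  move/eqP; rewrite open_prop_none => /orP[/eqP|/andP[/eqP h /eqP ?]]; first by left.
  by right; split=> // /val_inj.
have vis p p' b : d p = Some (p', b) -> (p < u < p')%N \/ (p < y < p')%N -> False.
  move=> E [|/andP[h1 h2]]; first exact: cup_uncovered_prop E.
  exact: diag_np E h1 h2 Ey.
split.
- move=> x x' b /open_propP[[->->->]|[->->->]|[E _ [? ? ?]]].
  + by split=> //; apply/eqP=> e; move: hyu; rewrite e ltnn.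
  + by split=> //; apply/eqP=> e; move: hyu; rewrite e ltnn.
  + by rewrite splice_far1 //; apply: diag_sym E.
- move=> x x' w w' b b' /open_propP V /open_propP W.
  case: V => [[->->_]|[->->_]|[E [? ? ?] [? ? ?]]];
  case: W => [[->->_]|[->->_]|[E' [? ? ?] [? ? ?]]]; try lia.
  + by have := vis _ _ _ E'; lia.
  + by have := vis _ _ _ E; lia.
  + exact: diag_nc E E'.
- move=> x x' b p /open_propP V h1 h2 /Dn P.
  case: V h1 h2 => [[->->_]|[->->_]|[E [? ? ?] [? ? ?]]] h1 h2; try lia.
    case: P => [e|[hp hpy]]; first by move: h2; rewrite e; lia.
    have [|p' Ep _] := cl (x := p); first by lia.
    by rewrite hp in Ep.
  case: P => [e|[hp _]]; last exact: diag_np E h1 h2 hp.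
  by move: h1 h2; rewrite e => h1 h2; apply: (vis _ _ _ E); lia.
- move=> x x' s p /open_propP[[? ? //]|[? ? //]|[E [? ? ?] _]] h /Dn[e|[hp _]].
    rewrite e in h.
    (* A blob obstructed by the moved line at [v] was already obstructed by the line at [y], unless
       it sits between them, where no blobs occur. *)
    have hy : (if s then y < x else x < y)%N.
      have [//|nh] := boolP (if s then y < x else x < y)%N.
      have [|x'' E'' _] := cl (x := x); last by rewrite E in E''.
      by case: (s) h nh => /=; lia.
    exact: diag_edge E hy Ey.
  exact: diag_edge E h hp.
- move=> x x' s a c b /open_propP[[? ? //]|[? ? //]|[E [? ? ?] _]] /open_propP W h1 h2.
  case: W h1 h2 => [[->->_]|[->->_]|[E' _ _]] h1 h2; try lia.
    have [|x'' E'' _] := cl (x := x); last by rewrite E in E''.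
    by lia.
  exact: diag_unc E E' h1 h2.
Qed.

End OpenPropagating.

(** * The cup action read backwards *)

Section CupAction.
Variables (n : nat) (k : fieldType) (dl0 dlL dlR kpL kpR : k).
Implicit Types (d : HD n) (x y z p u v : 'I_n).
Local Notation act := (act_cup (n := n) dl0 dlL dlR kpL kpR).
Local Notation join := (join_blobs dlL dlR).

(** Here [d] is the source and [d'] the target. Each constructor expresses the source as a splice of
    the target, so that a sum over sources becomes a sum over ways to reconnect the cup of the
    target. *)
Variant cup_step u v d d' : k -> Prop :=
| CupLoop b of d u = Some (v, b) & d = recolor d' u v b :
    cup_step u v d d' (loop_factor dl0 kpL kpR b)
| CupArcs y z b1 b2 c bb of d u = Some (y, b1) & d v = Some (z, b2)
    & [/\ (y : nat) <> u, (y : nat) <> v, (z : nat) <> u, (z : nat) <> v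
        & (y : nat) <> z]
    & join b1 b2 = Some (c, bb) & d' y = Some (z, bb)
    & d = splice d' u v (Some (y, b1)) (Some (z, b2)) : cup_step u v d d' c
| CupPropV y of d u = Some (y, None) & d v = None
    & (y : nat) <> u /\ (y : nat) <> v & d' y = None
    & d = splice d' u v (Some (y, None)) None : cup_step u v d d' 1
| CupPropU z of d u = None & d v = Some (z, None)
    & (z : nat) <> u /\ (z : nat) <> v & d' z = None
    & d = splice d' u v None (Some (z, None)) : cup_step u v d d' 1.

Lemma neq_val x y : x != y -> (x : nat) <> y.
Proof. by move/eqP => h /val_inj. Qed.

Lemma act_cupP u v d c d' : diagram d -> (u : nat) <> v ->
  act u v d = Some (c, d') -> d' u = Some (v, None) /\ cup_step u v d d' c.
Proof.
move=> dg nuv; have vu : (v == u) = false by apply/ord_neq/nesym.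
have uv : (u == v) = false by apply/ord_neq.
rewrite /act_cup.
case Eu: (d u) => [[y b]|]; last first.
  case Ev: (d v) => [[z [//|]]|//] [<- <-].
  have [nzv Ez] := diag_sym dg Ev.
  have zu : z == u = false by apply/eqP => e; rewrite e Eu in Ez.
  split; first by rewrite ffunE eq_sym zu eqxx.
  apply: (CupPropU (z := z)) => //.
  - by split; [apply/neq_val; rewrite zu|apply/neq_val].
  - by rewrite ffunE eqxx.
  apply/ffunP => x; rewrite !ffunE.
  have [->|] := eqVneq x u; first by rewrite Eu.
  have [->|] := eqVneq x v; first by rewrite Ev.
  by have [->|//] := eqVneq x z; rewrite Ez.
have [nyu Ey] := diag_sym dg Eu.
case: eqP => [yv [<- <-]|/eqP nyv].
  rewrite yv in Eu Ey nyu *.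
  split; first by rewrite ffunE eqxx.
  apply: CupLoop => //; apply/ffunP => x; rewrite !ffunE.
  have [->|] := eqVneq x u; first by rewrite Eu.
  by have [->|//] := eqVneq x v; rewrite Ey.
case Ev: (d v) => [[z b']|]; last first.
  case: b Eu Ey => // Eu Ey [<- <-].
  split; first by rewrite ffunE eq_sym (negPf nyu) eqxx.
  apply: (CupPropV (y := y)) => //.
  - by split; apply/neq_val.
  - by rewrite ffunE eqxx.
  apply/ffunP => x; rewrite !ffunE.
  have [->|] := eqVneq x u; first by rewrite Eu.
  have [->|] := eqVneq x v; first by rewrite Ev.
  by have [->|//] := eqVneq x y; rewrite Ey.
have [nzv Ez] := diag_sym dg Ev.
have nzu : z != u.
  by apply/eqP => e; rewrite e Eu in Ez; case: Ez => e'; rewrite e' eqxx in nyv.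
have nyz : y != z.
  apply/eqP => e; rewrite -e Ey in Ez; case: Ez => /esym e'.
  by rewrite e' eqxx in vu.
case J: join_blobs => [[c' bb]|//] [<- <-].
split; first by rewrite ffunE eq_sym (negPf nyu) eq_sym (negPf nzu) eqxx.
apply: (CupArcs (y := y) (z := z) Eu Ev _ J).
- by split; apply/neq_val.
- by rewrite ffunE eqxx.
apply/ffunP => x; rewrite !ffunE.
have [->|] := eqVneq x u; first by rewrite Eu.
have [->|] := eqVneq x v; first by rewrite Ev.
have [->|_] := eqVneq x y; first by rewrite Ey.
by have [->|//] := eqVneq x z; rewrite Ez.
Qed.

Lemma act_cup_recolor u v d b : diagram d -> d u = Some (v, None) ->
  act u v (recolor d u v b) = Some (loop_factor dl0 kpL kpR b, d).
Proof.
move=> dg Eu; have nuv := diag_neq dg Eu; have [nvu Ev] := diag_sym dg Eu.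
rewrite /act_cup !recolorE // !eqxx; congr (Some (_, _)).
apply/ffunP => x; rewrite !ffunE; have [->|] := eqVneq x u; first by rewrite Eu.
by have [->|//] := eqVneq x v; rewrite Ev.
Qed.

Lemma act_cup_arcs u v d y z b1 b2 bb c : diagram d ->
  d u = Some (v, None) -> d y = Some (z, bb) ->
  (y : nat) <> u -> (y : nat) <> v -> join b1 b2 = Some (c, bb) ->
  act u v (splice d u v (Some (y, b1)) (Some (z, b2))) = Some (c, d).
Proof.
move=> dg Eu Ey nyu nyv J; have nuv := diag_neq dg Eu.
have [_ Ev] := diag_sym dg Eu; have [_ Ez] := diag_sym dg Ey.
rewrite /act_cup splice_u splice_v // (ord_neq nyv) J; congr (Some (_, _)).
apply/ffunP => x; rewrite !ffunE.
have [->|_] := eqVneq x y; first by rewrite Ey.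
have [->|_] := eqVneq x z; first by rewrite Ez.
have [->|_] := eqVneq x u; first by rewrite Eu.
by have [->|_] := eqVneq x v; first by rewrite Ev.
Qed.

Lemma act_cup_prop u v d y : diagram d ->
  d u = Some (v, None) -> d y = None ->
  act u v (splice d u v (Some (y, None)) None) = Some (1, d).
Proof.
move=> dg Eu Ey; have nuv := diag_neq dg Eu.
have [_ Ev] := diag_sym dg Eu.
have nyv : (y == v) = false by apply/eqP => e; rewrite e Ev in Ey.
rewrite /act_cup splice_u splice_v // nyv; congr (Some (_, _)).
apply/ffunP => x; rewrite !ffunE.
have [->|_] := eqVneq x y; first by rewrite Ey.
have [->|_] := eqVneq x u; first by rewrite Eu.
by have [->|_] := eqVneq x v; first by rewrite Ev.
Qed.

End CupAction.

(** * Quantum numbers *)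

Section QuantumNumbers.
Variables (F : fieldType) (q : F).

(** The bracket [[x]] as a function of [X = q^x]. With [X] free, identities with symbolic exponents
    become rational identities that [field] decides. Then [qint j] is [[j]], and [qdown Q j] is
    [[w - j]] for [Q = q^w]. *)
Definition qbr (X : F) : F := (X - X^-1) / (q - q^-1).
Definition qint (j : nat) : F := qbr (q ^+ j).
Definition qdown (Q : F) (j : nat) : F := qbr (Q / q ^+ j).

Hypotheses (q0 : q != 0) (qq : q ^+ 2 != 1).

Lemma qqV : q - q^-1 != 0.
Proof.
apply: contraNneq qq => /eqP; rewrite subr_eq0 => /eqP e.
by rewrite expr2 {2}e mulfV.
Qed.

Lemma qint1 : qint 1 = 1.
Proof. by rewrite /qint /qbr expr1 divff // qqV. Qed.

Lemma qint0 : qint 0 = 0.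
Proof. by rewrite /qint /qbr expr0 invr1 subrr mul0r. Qed.

Let den_ok : q * q - 1 != 0.
Proof. by rewrite -expr2 subr_eq0. Qed.

Let qX a : q ^+ a != 0.
Proof. exact: expf_neq0. Qed.

Lemma qbr_step (A B : F) : A != 0 -> B != 0 ->
  qbr (A * B) * qbr (A * q) = qbr A * qbr (A * B * q) + qbr B.
Proof. by move=> A0 B0; rewrite /qbr; field; rewrite q0 A0 B0 den_ok. Qed.

Lemma qbr_down (A V : F) : A != 0 -> V != 0 ->
  qbr A * qbr V + qbr (V / (A * q)) = qbr (V / q) * qbr (A * q).
Proof. by move=> A0 V0; rewrite /qbr; field; rewrite q0 A0 V0 den_ok. Qed.

Lemma qbr_parent (A B : F) : A != 0 -> B != 0 ->
  - qbr (q * q) * qbr (A * q) * qbr (B * q) + qbr A * qbr (B * q)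
  + qbr B * qbr (A * q) = - qbr (A * B * q * q).
Proof. by move=> A0 B0; rewrite /qbr; field; rewrite q0 A0 B0 den_ok. Qed.

Lemma qbr_blobbed (A B C V : F) : A != 0 -> B != 0 -> C != 0 -> V != 0 ->
  qbr (A * B * q * q) * qbr (C * A * q) * qbr (V / (A * q)) =
  qbr (A * q) * qbr (C * A * B * q * q) * qbr (V / (A * q))
  + qbr (B * q) * qbr (C * A * q) * qbr V
  - qbr (V * C) * qbr (A * q) * qbr (B * q).
Proof.
by move=> A0 B0 C0 V0; rewrite /qbr; field; rewrite q0 A0 B0 C0 V0 den_ok.
Qed.

Lemma qbr_loop (A V : F) : A != 0 -> V != 0 ->
  - qbr (q * q) * qbr (A * q) * qbr V + qbr A * qbr V + qbr (V / q) * qbr (A * q)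
  = - qbr (V * A * q).
Proof. by move=> A0 V0; rewrite /qbr; field; rewrite q0 A0 V0 den_ok. Qed.

Lemma qint_step a X : qint a.+1 != 0 -> qint (a + X).+1 != 0 ->
  qint a / qint a.+1 + qint X / (qint a.+1 * qint (a + X).+1) =
  qint (a + X) / qint (a + X).+1.
Proof.
have := qbr_step (qX a) (qX X); rewrite -exprD -!exprSr -/(qint _) => E h1 h2.
have -> : qint X = qint (a + X) * qint a.+1 - qint a * qint (a + X).+1.
  by rewrite -!/(qint _) in E *; rewrite E addrC addKr.
by field; rewrite h1 h2.
Qed.

Variables (Q : F) (Q0 : Q != 0).

Let QX j : Q / q ^+ j != 0.
Proof. by rewrite mulf_neq0 ?invr_neq0. Qed.

Lemma qdownD b a : qdown Q (b + a) = qbr (Q / q ^+ b / q ^+ a).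
Proof. by rewrite /qdown exprD invfM mulrA. Qed.

(** Last step of a leftward chain that meets a right-blobbed arc: [a] is half the width already
    traversed, [b] half the number of vertices to the right of the cup. *)
Lemma qdown_step a b : qint a.+1 != 0 -> qdown Q b != 0 ->
  qint a / qint a.+1 + qdown Q (b + a.+1) / (qdown Q b * qint a.+1) =
  qdown Q b.+1 / qdown Q b.
Proof.
have := qbr_down (qX a) (QX b); rewrite -exprSr -!/(qint _) -/(qdown Q b).
rewrite -qdownD.
have -> : qbr (Q / q ^+ b / q) = qdown Q b.+1 by rewrite -addn1 qdownD expr1.
move=> E h1 h2.
have -> : qdown Q (b + a.+1) = qdown Q b.+1 * qint a.+1 - qint a * qdown Q b.
  by rewrite -E addrC addKr.
by field; rewrite h1 h2.
Qed.

(** On the left, the plain loop and two chains stopped by a surrounding arc; on the right, up to the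
    hook [[a+b+2]] of that arc in the numerator, minus the term in which it is cut into arcs with
    hooks [[a+1]] and [[b+1]]. *)
Lemma qint_parent a b : qint a.+1 != 0 -> qint b.+1 != 0 ->
  - qint 2 + qint a / qint a.+1 + qint b / qint b.+1 =
  - qint (a + b).+2 / (qint a.+1 * qint b.+1).
Proof.
have := qbr_parent (qX a) (qX b); rewrite -exprD -!exprSr -expr2 -!/(qint _).
move=> <- h1 h2; by field; rewrite h1 h2.
Qed.

(** The analogue for a blobbed surrounding arc, divided by its hook. Its blob can come from the
    outer piece, the inner piece, or both; the last case has the double-blob constant [-[w]], which
    is [- qdown Q 0]. *)
Lemma qint_blobbed a b c : qint a.+1 != 0 -> qint b.+1 != 0 ->
  qint (c + a).+1 != 0 -> qint (c + (a + b)).+2 != 0 -> qdown Q c != 0 ->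
  qdown Q (c + a.+1) != 0 ->
  (- qint 2 + qint a / qint a.+1 + qint b / qint b.+1)
    / (qint (c + (a + b)).+2 * qdown Q c)
  + (qint (c + a).+1 * qdown Q c * qint b.+1)^-1
  + (qint a.+1 * (qint (c + (a + b)).+2 * qdown Q (c + a.+1)))^-1
  - qdown Q 0 / (qint (c + a).+1 * qdown Q c
                 * (qint (c + (a + b)).+2 * qdown Q (c + a.+1))) = 0.
Proof.
move=> h1 h2 h3 h4 h5 h6; rewrite qint_parent //.
have := qbr_blobbed (qX a) (qX b) (qX c) (QX c).
rewrite -!exprD -!exprSr -(addnA c a b) -!/(qint _) -/(qdown Q c).
rewrite divfK // -qdownD.
have -> : qbr Q = qdown Q 0 by rewrite /qdown expr0 divr1.
rewrite !addnS => E.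
set x := (X in X = 0).
have -> : x = (- (qint (a + b).+2 * qint (c + a).+1 * qdown Q (c + a).+1)
  + (qint a.+1 * qint (c + (a + b)).+2 * qdown Q (c + a).+1 +
     qint b.+1 * qint (c + a).+1 * qdown Q c - qdown Q 0 * qint a.+1 * qint b.+1))
  / (qint a.+1 * qint b.+1 * qint (c + a).+1 * qint (c + (a + b)).+2 * qdown Q c
     * qdown Q (c + a).+1).
  rewrite addnS in h6; rewrite /x; field; by rewrite h1 h2 h3 h4 h5 h6.
by rewrite E addNr mul0r.
Qed.

(** Plain loop, chain reaching the edge, and blobbed loop: here [qbr (Q * q)] is the loop value
    [[w+1]], and the cup at that edge would have blobbed hook [[a+1][w-a]]. *)
Lemma qint_loop a : qint a.+1 != 0 -> qdown Q a != 0 ->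
  - qint 2 + qint a / qint a.+1 + qbr (Q * q) / (qint a.+1 * qdown Q a) =
  - (qdown Q a.+1 / qdown Q a).
Proof.
move=> h1 h2; have := qbr_loop (qX a) (QX a).
rewrite -exprSr -expr2 -!/(qint _) -/(qdown Q a).
have -> : qbr (Q / q ^+ a / q) = qdown Q a.+1 by rewrite -addn1 qdownD expr1.
rewrite divfK // => E; apply/eqP; rewrite -subr_eq0; apply/eqP.
set x := (X in X = 0).
have -> : x = (- qint 2 * qint a.+1 * qdown Q a + qint a * qdown Q a
  + qdown Q a.+1 * qint a.+1 + qbr (Q * q)) / (qint a.+1 * qdown Q a).
  by rewrite /x; field; rewrite h1 h2.
by rewrite E addNr mul0r.
Qed.

End QuantumNumbers.

(** * Hook weights and the siblings of a cup *)

Lemma prod_agree (R : comNzRingType) (I : finType) (s : seq I) (f g : I -> R) :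
  uniq s -> (forall x, x \notin s -> f x = g x) ->
  \prod_x f x * \prod_(x <- s) g x = \prod_x g x * \prod_(x <- s) f x.
Proof.
move=> us fg; rewrite !(big_uniq _ us) /=.
rewrite (bigID (mem s)) [X in _ = X * _](bigID (mem s)) /=.
rewrite (eq_bigr g (fun x h => fg x h)); ring.
Qed.

Section Weights.
Variables (n : nat) (F : fieldType) (q : F).
Implicit Types (d D : HD n) (x y z p u v : 'I_n).
Local Notation qi := (qint q).

Section Hooks.
Variables (Q1 Q2 : F) (sg : 'I_n -> F).
Local Notation W1 := (qdown q Q1).
Local Notation W2 := (qdown q Q2).

(** Vertices count from [0]. The halves are exact in a diagram, because the vertices beneath an arc,
    or between a blobbed arc and its edge, are matched among themselves. *)
Definition arc_hook (x y : nat) (b : blob) : F :=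
  match b with
  | None => qi ((y - x).+1)./2
  | Some true => qi (y.+1)./2 * W1 x./2
  | Some false => qi ((n - x.+1).+1)./2 * W2 (n - y.+1)./2
  end.

(** The signs [sg] stay abstract because the rule modulo [4 * l] is not invariant under reflection;
    its shape matters only at the root of unity. *)
Definition hook d x : F :=
  match d x with
  | None => sg x
  | Some (y, b) => if (x < y)%N then arc_hook x y b else 1
  end.

(** The hook value without its numerator, which is common to all diagrams and carries the factor
    [[l]]. *)
Definition weight d : F := (\prod_x hook d x)^-1.

Definition cup_coef u v (d' : HD n) (D : HD n) : F :=
  if act_cup (- qi 2) (- W1 0) (- W2 0) (qbr q (Q1 * q)) (qbr q (Q2 * q)) u v D
     is Some (c, D'') then if D'' == d' then c * weight D else 0 else 0.

Definition ltype u v D : bool :=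
  if D u is Some (y, _) then (y < u)%N && (if D v is Some (z, _) then z < u else true)%N
  else false.

Definition rtype u v D : bool :=
  if D v is Some (y, _) then (v < y)%N && (if D u is Some (z, _) then v < z else true)%N
  else false.

Definition uncovered d u := forall a c b, d a = Some (c, b) -> (a < u < c)%N -> False.

(** The value of the left sum depends only on what ends the chain of siblings. A left-blobbed
    sibling counts as the edge, hence falls under [LeftFree]. A right-blobbed sibling is described
    by the space to the right of the cup, since its blob forces that side to be free of propagating
    lines. *)
Variant left_end d u v : F -> Prop :=
| LeftFree a of u = (2 * a)%N :> nat & (forall x, (x < u)%N -> d x <> None)
    & uncovered d u : left_end d u v (qi a / qi a.+1)
| LeftProp p a of u = (p + 2 * a).+1 :> nat & d p = None & closed_on d p.+1 u
    & uncovered d u : left_end d u v ((qi a + sg p / sg v) / qi a.+1)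
| LeftParent y z b a of u = (y + 2 * a).+1 :> nat & d y = Some (z, b)
    & (v < z)%N & closed_on d y.+1 u : left_end d u v (qi a / qi a.+1)
| LeftBlob b of n = (v.+1 + 2 * b)%N & (forall x, (v < x)%N -> d x <> None)
    & uncovered d u : left_end d u v (W2 b.+1 / W2 b).

(** What makes every hook invertible. It holds for indeterminates and fails at the root of unity,
    where [[l]] vanishes. *)
Record generic : Prop := Generic {
  generic_q0 : q != 0;
  generic_qq : q ^+ 2 != 1;
  generic_Q1 : Q1 != 0;
  generic_Q2 : Q2 != 0;
  generic_qint : forall j, (0 < j)%N -> qi j != 0;
  generic_qdown1 : forall j, W1 j != 0;
  generic_qdown2 : forall j, W2 j != 0;
  generic_sg : forall x, sg x != 0 }.

End Hooks.

Section LeftSum.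
Variables (Q1 Q2 : F) (sg : 'I_n -> F).
Local Notation W1 := (qdown q Q1).
Local Notation W2 := (qdown q Q2).
Hypothesis G : generic Q1 Q2 sg.
Local Notation q0 := (generic_q0 G).
Local Notation qq := (generic_qq G).
Local Notation Q10 := (generic_Q1 G).
Local Notation Q20 := (generic_Q2 G).
Local Notation qi0 := (generic_qint G).
Local Notation W10 := (generic_qdown1 G).
Local Notation W20 := (generic_qdown2 G).
Local Notation sg0 := (generic_sg G).
Local Notation ahk := (arc_hook Q1 Q2).
Local Notation hk := (hook Q1 Q2 sg).
Local Notation wt := (weight Q1 Q2 sg).
Local Notation cf := (cup_coef Q1 Q2 sg).

Lemma arc_hook_neq0 (x y : 'I_n) b : (x < y)%N -> ahk x y b != 0.
Proof.
move=> h; have := ltn_ord y.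
by case: b => [[]|] /= ?; [apply: mulf_neq0|apply: mulf_neq0|];
  rewrite ?W10 ?W20 //; apply: qi0; lia.
Qed.

Lemma hook_neq0 d x : hk d x != 0.
Proof.
rewrite /hook; case: (d x) => [[y b]|]; last exact: sg0.
by case: ifP => [/arc_hook_neq0->//|_]; rewrite oner_eq0.
Qed.

Lemma weight_agree d D s : uniq s -> (forall x, x \notin s -> D x = d x) ->
  wt D = wt d * ((\prod_(x <- s) hk d x) / \prod_(x <- s) hk D x).
Proof.
move=> us E; have H : \prod_x hk D x * \prod_(x <- s) hk d x =
    \prod_x hk d x * \prod_(x <- s) hk D x.
  by apply: prod_agree => // x h; rewrite /hook E.
have hD : \prod_x hk D x != 0 by apply/prodf_neq0 => x _; apply: hook_neq0.
have hd : \prod_x hk d x != 0 by apply/prodf_neq0 => x _; apply: hook_neq0.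
have hsD : \prod_(x <- s) hk D x != 0.
  by rewrite prodf_seq_neq0; apply/allP => x _; rewrite hook_neq0.
rewrite /weight; move: H hD hd hsD.
set A := \prod_x _; set a := \prod_(x <- s) _; set B := \prod_x _.
set b := \prod_(x <- s) _ => H A0 B0 b0.
have -> : a = B * b / A by rewrite -H mulrAC divff ?mul1r.
by field; rewrite A0 B0 b0.
Qed.

Lemma hook_arc d x y b : d x = Some (y, b) -> (x < y)%N -> hk d x = ahk x y b.
Proof. by rewrite /hook => -> ->. Qed.

Lemma hook_right d x y b : d x = Some (y, b) -> (y < x)%N -> hk d x = 1.
Proof. by rewrite /hook => -> h; rewrite ltnNge ltnW. Qed.

Lemma hook_none d x : d x = None -> hk d x = sg x.
Proof. by rewrite /hook => ->. Qed.

Section Cup.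
Variables (l : nat) (d : HD n) (u v : 'I_n).
Hypotheses (vd : valid l d) (huv : v = u.+1 :> nat) (Eu : d u = Some (v, None)).

Let dg : diagram d. Proof. by case/validP: vd. Qed.
Let Ev : d v = Some (u, None). Proof. exact: (diag_sym dg Eu).2. Qed.
Let nuv : (u : nat) <> v. Proof. lia. Qed.

Lemma hook_cup : hk d u = 1.
Proof.
rewrite (hook_arc Eu) /arc_hook; last by lia.
have -> : ((v - u).+1)./2 = 1%N by lia.
exact: (qint1 q0 qq).
Qed.

Lemma sum_cup_none (P : pred (HD n)) :
  (forall D, valid l D -> P D -> cf u v d D <> 0 -> False) ->
  \sum_(D | valid l D && P D) cf u v d D = 0.
Proof.
move=> H; apply: big1 => D /andP[h1 h2]; apply/eqP/negP => /negP/eqP h3.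
exact: H h1 h2 h3.
Qed.

Lemma sum_cup_one (P : pred (HD n)) D0 : valid l D0 -> P D0 ->
  (forall D, valid l D -> P D -> cf u v d D <> 0 -> D = D0) ->
  \sum_(D | valid l D && P D) cf u v d D = cf u v d D0.
Proof.
move=> h1 h2 H; rewrite (bigD1 D0) /= ?h1 // big1 ?addr0 //.
move=> D /andP[/andP[h3 h4] /eqP h5]; apply/eqP/negP => /negP/eqP h6.
by apply: h5; apply: H.
Qed.

Lemma cup_coef_step D : valid l D -> cf u v d D <> 0 -> exists2 c,
  cf u v d D = c * wt D &
  cup_step (- qi 2) (- W1 0) (- W2 0) (qbr q (Q1 * q)) (qbr q (Q2 * q)) u v D d c.
Proof.
case/validP=> dgD _; rewrite /cup_coef.
case E: act_cup => [[c D']|//]; case: eqP => [e|//] _; exists c => //.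
by rewrite e in E; case: (act_cupP dgD nuv E).
Qed.

(** The arc [(y, u)] is undecorated for one of two reasons: it lies beneath [(z, v)], or a blobbed
    arc joined to a propagating line would give [0]. *)
Lemma left_contrib D : valid l D -> ltype u v D -> cf u v d D <> 0 ->
  exists y, [/\ (y < u)%N, D u = Some (y, None), D y = Some (u, None),
    forall x, (x : nat) <> u -> (x : nat) <> v -> (x : nat) <> y ->
      (forall b, d y <> Some (x, b)) -> D x = d x &
    (exists z b, [/\ (z < y)%N, d y = Some (z, b) &
       D = splice d u v (Some (y, None)) (Some (z, b))]) \/
    (d y = None /\ D = splice d u v (Some (y, None)) None)].
Proof.
move=> vD lt nz; have [dgD _] := validP _ _ vD.
have [c _ []] := cup_coef_step vD nz.
- by move=> b E; move: lt; rewrite /ltype E; lia.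
- move=> y z b1 b2 c' bb E1 E2 [? ? ? ? nyz] J E3 ED.
  have /andP[hy hz] : (y < u)%N && (z < u)%N by move: lt; rewrite /ltype E1 E2.
  have Dy := (diag_sym dgD E1).2; have Dz := (diag_sym dgD E2).2.
  have hzy : (z < y)%N by have := diag_nc dgD Dy Dz; lia.
  have hb1 : b1 = None by apply: (covered_undec dgD Dz E1); lia.
  subst b1; case: J => _ hb; subst b2.
  exists y; split=> //; last by left; exists z, bb.
  move=> x h1 h2 h3 h4; rewrite ED splice_far //.
  by move=> /val_inj e; apply: (h4 bb); rewrite e.
- move=> y E1 E2 [? ?] E3 ED.
  have hy : (y < u)%N by move: lt; rewrite /ltype E1 E2 andbT.
  have Dy := (diag_sym dgD E1).2.
  exists y; split=> //; last by right.
  by move=> x h1 h2 h3 _; rewrite ED splice_far1.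
- by move=> z E1; move: lt; rewrite /ltype E1.
Qed.

Let pos (D : HD n) : nat := if D u is Some (y, _) then y else 0%N.
(** Partial sums by the position of the partner of [u]; the chain of siblings is traversed by
    lowering [i] past one arc at a time. *)
Let S (i : nat) :=
  \sum_(D | valid l D && (ltype u v D && (i <= pos D)%N)) cf u v d D.

Let S_split i j : (i <= j)%N -> S i = S j +
  \sum_(D | valid l D && (ltype u v D && (i <= pos D < j)%N)) cf u v d D.
Proof.
move=> h; rewrite /S (bigID (fun D => j <= pos D)%N) /=.
congr (_ + _); apply: eq_bigl => D; case: (valid l D) => //=;
  case: (ltype u v D) => //=; lia.
Qed.

Let S_u : S u = 0.
Proof.
apply: sum_cup_none => D vD /andP[lt h] _; move: lt h; rewrite /ltype /pos.
by case: (D u) => [[y b]|//] /andP[]; lia.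
Qed.

Section Sibling.
Variables (y z : 'I_n) (b : blob).
Hypotheses (Ey : d y = Some (z, b)) (hyu : (y < u)%N) (hzy : (z < y)%N).
Hypothesis cl : closed_on d y.+1 u.

Let D0 := splice d u v (Some (y, None)) (Some (z, b)).

Let far_y p p' s : (y < p < u)%N -> d p = Some (p', s) -> (y < p' < u)%N /\ s = None.
Proof. by move=> /cl[p'' E h] E'; rewrite E in E'; case: E' => <- <-. Qed.

Lemma sibling_valid : valid l D0.
Proof.
have Ez := (diag_sym dg Ey).2.
have inz : forall p, (z < p < y)%N -> exists2 p', d p = Some (p', None) & (z < p' < y)%N.
  exact: (inside_closed dg Ez).
apply/validP; split; last first.
  by rewrite (open_nprop None b dg huv Eu Ey); [case/validP: vd|lia|lia].
apply: (open_diagram (bb := b)) => //.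
- by rewrite hzy.
- move=> p p' c E hp npy npz.
  have nzp' : (p' : nat) <> z.
    by move=> /val_inj e; apply: npy; rewrite e in E; have := (diag_sym dg E).2; rewrite Ez => -[].
  have nyp' : (p' : nat) <> y.
    by move=> /val_inj e; apply: npz; rewrite e in E; have := (diag_sym dg E).2; rewrite Ey => -[].
  have nup' : (p' : nat) <> u.
    by move=> /val_inj e; rewrite e in E; have := (diag_sym dg E).2; rewrite Eu => -[e' _]; move: hp; rewrite e -e'; lia.
  have np : (p : nat) <> y by move=> /val_inj.
  have H1 : (y < p < u)%N -> (y < p' < u)%N by move=> /far_y/(_ E)[].
  have H2 : (y < p' < u)%N -> (y < p < u)%N.
    by move=> /far_y/(_ (diag_sym dg E).2)[].
  by lia.
- move=> p; case/or3P => hp; last by lia.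
    by have [p' ->] := cl hp.
  have [e|[e|[hh|hh]]] : (p : nat) = y \/ (p : nat) = u \/ (z < p < y)%N \/ (y < p < u)%N by lia.
  + by rewrite (val_inj e) Ey.
  + by rewrite (val_inj e) Eu.
  + by have [p' ->] := inz _ hh.
  + by have [p' ->] := cl hh.
- move=> p p' s; case/or3P => hp E; last by lia.
    by have [_] := far_y hp E.
  have [e|[e|[hh|hh]]] : (p : nat) = y \/ (p : nat) = u \/ (z < p < y)%N \/ (y < p < u)%N by lia.
  + by left; apply: val_inj.
  + by move: E; rewrite (val_inj e) Eu.
  + by have [p''] := inz _ hh; rewrite E.
  + by have [_] := far_y hh E.
Qed.

Lemma sibling_coef : cf u v d D0 =
  wt d * (ahk z y b / (ahk y u None * ahk z v b)).
Proof.
have Ez := (diag_sym dg Ey).2.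
rewrite /cup_coef (@act_cup_arcs _ F _ _ _ _ _ u v d y z None b b 1 dg Eu Ey); try lia; last by case: (b).
rewrite eqxx mul1r (weight_agree (s := [:: u; v; y; z]) (d := d)); first last.
- move=> x; rewrite !inE !negb_or => /and4P[/neq_val ? /neq_val ? /neq_val ? /neq_val ?].
  by rewrite splice_far.
- by rewrite /= !inE !ord_neq //; lia.
have [Du Dv Dy Dz] : [/\ D0 u = Some (y, None), D0 v = Some (z, b),
    D0 y = Some (u, None) & D0 z = Some (v, b)].
  by apply: (open_at None b dg huv Ey hyu); rewrite hzy.
rewrite !big_cons !big_nil -/D0 hook_cup (hook_right Ev) ?(hook_right Ey) ?(hook_arc Ez) //; last by lia.
rewrite (hook_right Du) // (hook_right Dv) ?(hook_arc Dy) ?(hook_arc Dz) //; try lia.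
by rewrite !mul1r !mulr1.
Qed.

(** A partner of [u] strictly inside the sibling would create an arc crossing it, as the sibling is
    then left untouched; the partner [z] is excluded by the orientation. *)
Lemma sibling_contrib D : valid l D -> ltype u v D -> cf u v d D <> 0 ->
  (z <= pos D < y.+1)%N -> D = D0.
Proof.
move=> vD lt nz; have [dgD _] := validP _ _ vD.
have Ez := (diag_sym dg Ey).2.
have [y' [hy' Du Dy' far H]] := left_contrib vD lt nz.
rewrite /pos Du => hp.
have [/val_inj e|ne] := eqVneq (y' : nat) y.
  case: H => [[z' [b' [_]]]|[]]; rewrite e Ey; last by [].
  by case=> <- <- ->.
have [/val_inj e|ne'] := eqVneq (y' : nat) z.
  by case: H => [[z' [b' [h]]]|[]]; rewrite e Ez // => -[h' _]; move: h; rewrite -h' e; lia.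
have hz : (z < y' < y)%N by lia.
have [y'' Ey' h''] := inside_closed dg Ez hz.
have Dz : D z = Some (y, b).
  rewrite far //; try lia.
  by move=> b'; rewrite Ey' => -[e _]; move: h''; rewrite e; lia.
by have := diag_nc dgD Dz Dy'; lia.
Qed.

(** Beyond a blobbed sibling the chain stops: the arc from [u] would pass over its blob. *)
Lemma sibling_contrib_blob s D : b = Some s ->
  valid l D -> ltype u v D -> cf u v d D <> 0 -> (pos D < z)%N -> False.
Proof.
move=> hb vD lt nz; have [dgD _] := validP _ _ vD.
have [y' [hy' Du Dy' far H]] := left_contrib vD lt nz.
rewrite /pos Du => hp.
have Dz : D z = Some (y, b).
  rewrite far; try lia; first exact: (diag_sym dg Ey).2.
  move=> b' E; have := (diag_sym dg E).2; rewrite (diag_sym dg Ey).2 => -[e _].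
  by move: hp; rewrite -e; lia.
by rewrite hb in Dz; have := diag_unc dgD Dz Dy'; lia.
Qed.

End Sibling.

Section PropEnd.
Variable y : 'I_n.
Hypotheses (Ey : d y = None) (hyu : (y < u)%N) (cl : closed_on d y.+1 u).

Let D0 := splice d u v (Some (y, None)) None.

Lemma prop_end_valid : valid l D0.
Proof.
apply/validP; split; first exact: open_prop_diagram.
by rewrite (open_prop_nprop dg huv Eu) //; case/validP: vd.
Qed.

Lemma prop_end_coef : cf u v d D0 = wt d * (sg y / (sg v * ahk y u None)).
Proof.
rewrite /cup_coef act_cup_prop // eqxx mul1r.
rewrite (weight_agree (s := [:: u; v; y]) (d := d)); first last.
- move=> x; rewrite !inE !negb_or => /and3P[/neq_val ? /neq_val ? /neq_val ?].
  by rewrite splice_far1.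
- by rewrite /= !inE !ord_neq //; lia.
have [Du Dv Dy] := open_prop_at d huv hyu.
rewrite !big_cons !big_nil hook_cup (hook_right Ev) ?(hook_none Ey) //; last by lia.
rewrite (hook_right Du) // (hook_none Dv) (hook_arc Dy) //.
by rewrite !mul1r !mulr1.
Qed.

Lemma prop_end_contrib D : valid l D -> ltype u v D -> cf u v d D <> 0 ->
  (pos D < y.+1)%N -> D = D0.
Proof.
move=> vD lt nz; have [dgD _] := validP _ _ vD.
have [y' [hy' Du Dy' far H]] := left_contrib vD lt nz.
rewrite /pos Du => hp.
have [/val_inj e|ne] := eqVneq (y' : nat) y.
  by case: H => [[z' [b' [_]]]|[]]; rewrite e Ey.
have Dy : D y = None.
  rewrite far //; try lia.
  by move=> b' E; have := (diag_sym dg E).2; rewrite Ey.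
by exfalso; apply: (diag_np dgD Dy' _ _ Dy); lia.
Qed.

End PropEnd.

Lemma parent_contrib y z b D : d y = Some (z, b) -> (y < u)%N -> (v < z)%N ->
  valid l D -> ltype u v D -> cf u v d D <> 0 -> (pos D < y.+1)%N -> False.
Proof.
move=> Ey hyu hvz vD lt nz; have [dgD _] := validP _ _ vD.
have [y' [hy' Du Dy' far H]] := left_contrib vD lt nz.
rewrite /pos Du => hp.
have [/val_inj e|ne] := eqVneq (y' : nat) y.
  by case: H => [[z' [b' [h]]]|[]]; rewrite e Ey // => -[e' _]; move: h; rewrite -e' e; lia.
have Dy : D y = Some (z, b).
  rewrite far //; try lia.
  by move=> b' E; have := (diag_sym dg E).2; rewrite Ey => -[e _]; move: hvz; rewrite e; lia.
by have := diag_nc dgD Dy' Dy; lia.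
Qed.

Lemma closed_step y z : d y = Some (z, None) -> (z < y)%N ->
  closed_on d y.+1 u -> (y < u)%N -> closed_on d z u.
Proof.
move=> Ey hzy cl hyu x hx; have Ez := (diag_sym dg Ey).2.
have [/val_inj e|[/val_inj e|[h|h]]] : (x : nat) = z \/ (x : nat) = y \/
    (z < x < y)%N \/ (y < x < u)%N by lia.
- by rewrite e; exists y => //; lia.
- by rewrite e; exists z => //; lia.
- by have [x' E h'] := inside_closed dg Ez h; exists x' => //; lia.
- by have [x' E h'] := cl x h; exists x' => //; lia.
Qed.

Lemma closed_uncovered_blob y z s : d y = Some (z, Some s) -> (z < y)%N ->
  closed_on d y.+1 u -> (y < u)%N -> uncovered d u.
Proof.
move=> Ey hzy cl hyu a c b E h.
have ay : (a : nat) <> y.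
  by move=> /val_inj e; move: E; rewrite e Ey => -[e' _]; move: h; rewrite -e'; lia.
have [hay|hya] : (a < y)%N \/ (y < a)%N by lia.
  by apply: (diag_unc dg Ey E); lia.
by have [|c' E'] := cl a; [lia|rewrite E in E'; case: E' => <- _; lia].
Qed.

Lemma left_closed : uncovered d u -> (forall x, (x < u)%N -> d x <> None) ->
  exists a, u = (2 * a)%N :> nat.
Proof.
move=> unc np; have [||a ->] := @closed_even _ d 0 u dg; last by exists a.
  move=> x hx; case E: (d x) => [[y b]|]; last by exfalso; apply: (np x _ E); lia.
  exists y, b; split=> //; case: (ltnP y u) => // h.
  have nyu : (y : nat) <> u.
    move=> /val_inj e; rewrite e in E; have := (diag_sym dg E).2.
    by rewrite Eu => -[e' _]; move: hx; rewrite -e'; lia.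
  by exfalso; apply: (unc _ _ _ E); lia.
by have := ltn_ord u; lia.
Qed.

Lemma right_closed : uncovered d u -> (forall x, (v < x)%N -> d x <> None) ->
  exists a, n = (v.+1 + 2 * a)%N.
Proof.
move=> unc np; have [||a E] := @closed_even _ d v.+1 n dg; last by exists a.
  move=> x hx; case E: (d x) => [[y b]|]; last by exfalso; apply: (np x _ E); lia.
  exists y, b; split=> //; rewrite ltn_ord andbT; case: (ltnP v y) => // h.
  have E' := (diag_sym dg E).2.
  have nyv : (y : nat) <> v.
    by move=> /val_inj e; rewrite e Ev in E'; case: E' => e' _; move: hx; rewrite -e'; lia.
  have nyu : (y : nat) <> u.
    by move=> /val_inj e; rewrite e Eu in E'; case: E' => e' _; move: hx; rewrite -e'; lia.
  by exfalso; apply: (unc _ _ _ E'); lia.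
by have := ltn_ord v; lia.
Qed.

Let outcome val := left_end Q2 sg d u v val /\
  \sum_(D | valid l D && ltype u v D) cf u v d D = wt d * val.

Let S_0 : \sum_(D | valid l D && ltype u v D) cf u v d D = S 0.
Proof. by apply: eq_bigl => D; rewrite leq0n andbT. Qed.

(** Induction along the chain, with [i] the left end of the part traversed and [a] its half width.
    An undecorated sibling keeps the shape [[a]/[a+1]] of the partial sum; anything else ends the
    chain. *)
Lemma left_chain m i a : (i <= m)%N -> u = (i + 2 * a)%N :> nat ->
  closed_on d i u -> S i = wt d * (qi a / qi a.+1) -> exists val, outcome val.
Proof.
elim: m i a => [|m IH] i a him hu cl Si.
  have i0 : i = 0%N by lia.
  exists (qi a / qi a.+1); split; last by rewrite S_0 -Si i0.
  apply: LeftFree; first by lia.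
    by move=> x hx; have [|x' ->] := cl x; first by lia.
  move=> p c b E h; have [|c' E' h'] := cl p; first by lia.
  by rewrite E in E'; case: E' h' => <- _; lia.
case: (posnP i) => [i0|ipos]; first by apply: (IH i a) => //; lia.
have hy : (i.-1 < n)%N by have := ltn_ord u; lia.
pose y := Ordinal hy; have vy : (y : nat) = i.-1 by [].
have hi : i = y.+1 by lia.
have hyu : (y < u)%N by lia.
have cly : closed_on d y.+1 u by rewrite -hi.
have ha : qi a.+1 != 0 by apply: qi0.
have hS : S 0 = S i +
    \sum_(D | valid l D && (ltype u v D && (0 <= pos D < y.+1)%N)) cf u v d D.
  by rewrite -hi; apply: S_split.
have yu : ahk y u None = qi a.+1.
  by rewrite /arc_hook; congr (qi _); lia.
case Ey: (d y) => [[z b]|]; last first.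
  exists ((qi a + sg y / sg v) / qi a.+1); split.
    apply: LeftProp => //; first by lia.
    by move=> p c b E h; apply: (cup_uncovered_prop (y := y) (v := v)) E h.
  rewrite S_0 hS (sum_cup_one (D0 := splice d u v (Some (y, None)) None)).
  - rewrite prop_end_coef // Si yu; field.
    by rewrite sg0 ha.
  - exact: prop_end_valid.
  - by rewrite /ltype /pos splice_u splice_v //; lia.
  - by move=> D vD /andP[lt /andP[_ h]] nz; apply: prop_end_contrib.
have nzy : (y : nat) <> z := diag_neq dg Ey.
have Ez := (diag_sym dg Ey).2.
have nzu : (z : nat) <> u.
  by move=> /val_inj e; rewrite e Eu in Ez; case: Ez => e'; move: hyu; rewrite -e'; lia.
have nzv : (z : nat) <> v.
  by move=> /val_inj e; rewrite e Ev in Ez; case: Ez => /(f_equal (@nat_of_ord n)); lia.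
have [hvz|hzu] : (v < z)%N \/ (z < u)%N by lia.
  exists (qi a / qi a.+1); split; first by apply: (LeftParent _ _ _ Ey) => //; lia.
  rewrite S_0 hS Si sum_cup_none ?addr0 // => D vD /andP[lt /andP[_ h]] nz.
  exact: parent_contrib Ey hyu hvz vD lt nz h.
have hz : (z < y)%N.
  case: (ltnP z y) => // hyz; have [|z' Ez' hz'] := cl z; first by lia.
  by move: hz'; rewrite Ez in Ez'; case: Ez' => <- _; lia.
have vD0 : valid l (splice d u v (Some (y, None)) (Some (z, b))).
  exact: sibling_valid.
have pD0 : ltype u v (splice d u v (Some (y, None)) (Some (z, b))).
  by rewrite /ltype splice_u splice_v //; lia.
have qD0 : pos (splice d u v (Some (y, None)) (Some (z, b))) = y.
  by rewrite /pos splice_u.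
have [X hX] := arc_even dg Ez hz.
case: b Ey Ez vD0 pD0 qD0 => [s|] Ey Ez vD0 pD0 qD0; last first.
  apply: (IH z (a + X.+1)%N); [lia|lia|exact: closed_step Ey hz cly hyu|].
  have -> : S z = S i +
      \sum_(D | valid l D && (ltype u v D && (z <= pos D < y.+1)%N)) cf u v d D.
    by rewrite -hi; apply: S_split; lia.
  rewrite (sum_cup_one (D0 := splice d u v (Some (y, None)) (Some (z, None)))) //.
  - rewrite sibling_coef // Si yu -mulrDr; congr (_ * _).
    rewrite -(qint_step q0 qq) ?qi0 //; congr (_ + _ / (_ * _));
      by rewrite /arc_hook; congr (qi _); lia.
  - by rewrite pD0 qD0; lia.
  - by move=> D vD /andP[lt h] nz; apply: (sibling_contrib Ey).
have unc := closed_uncovered_blob Ey hz cly hyu.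
have tot : S 0 = wt d * (qi a / qi a.+1 +
   ahk z y (Some s) / (ahk y u None * ahk z v (Some s))).
  rewrite hS (sum_cup_one (D0 := splice d u v (Some (y, None)) (Some (z, Some s)))) //.
  - by rewrite sibling_coef // Si -mulrDr.
  - by rewrite pD0 qD0; lia.
  - move=> D vD /andP[lt h] nz; apply: (sibling_contrib Ey) => //.
    have := sibling_contrib_blob Ey hyu hz erefl vD lt nz; lia.
case: s Ey Ez vD0 pD0 qD0 tot => Ey Ez vD0 pD0 qD0 tot.
  have np x : (x < u)%N -> d x <> None.
    move=> hx; have [h|[/val_inj->|h]] : (x < y)%N \/ (x : nat) = y \/ (y < x < u)%N by lia.
    - exact: diag_edge Ey h.
    - by rewrite Ey.
    - by have [x' ->] := cly x h.
  have [al hal] := left_closed unc np.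
  exists (qi al / qi al.+1); split; first exact: LeftFree.
  rewrite S_0 tot yu; congr (_ * _).
  (* The first factor of a left-blobbed hook counts from the edge, so everything from the edge to
     [y] acts like one sibling of half width [al - a]; the [w1] factors cancel. *)
  have -> : al = (a + (al - a))%N by lia.
  rewrite -(qint_step q0 qq) ?qi0 // /arc_hook; congr (_ + _).
  have -> : (y.+1)./2 = (al - a)%N by lia.
  have -> : (v.+1)./2 = (a + (al - a)).+1 by lia.
  by field; rewrite W10 !qi0.
have np x : (v < x)%N -> d x <> None.
  by move=> hx; apply: (diag_edge dg Ey); lia.
have [be hbe] := right_closed unc np.
exists (W2 be.+1 / W2 be); split; first exact: LeftBlob.
(* The arcs [(z, y)] and [(z, v)] share their first hook factor, so only the [w2] factors, at
   [be + a.+1] and [be], survive. *)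
rewrite S_0 tot yu -(qdown_step q0 qq Q20 (a := a)) ?W20 //; congr (_ * (_ + _)).
rewrite /arc_hook.
have -> : (n - y.+1)./2 = (be + a.+1)%N by lia.
have -> : (n - v.+1)./2 = be by lia.
have hh : qi ((n - z.+1).+1)./2 != 0 by apply: qi0; have := ltn_ord y; lia.
by field; rewrite W20 ha hh.
Qed.

Lemma left_sum : exists2 val, left_end Q2 sg d u v val &
  \sum_(D | valid l D && ltype u v D) cf u v d D = wt d * val.
Proof.
have [||||val []] := @left_chain u u 0%N; [by []|by lia| |  |by exists val].
  by move=> x; lia.
by rewrite S_u qint0 mul0r mulr0.
Qed.

End Cup.
End LeftSum.
End Weights.

(** * Reflection *)

Section Mirror.
Variable n : nat.
Implicit Types (d D : HD n) (x y z p u v : 'I_n) (b : blob).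

Definition flip (b : blob) : blob := omap negb b.

Lemma flipK : involutive flip. Proof. by case=> [[]|]. Qed.

Definition mirror d : HD n :=
  [ffun x => if d (rev_ord x) is Some (y, b) then Some (rev_ord y, flip b)
             else None].

Lemma mirrorK : involutive mirror.
Proof.
move=> d; apply/ffunP => x; rewrite !ffunE rev_ordK.
by case: (d x) => [[y b]|] //; rewrite rev_ordK flipK.
Qed.

Lemma mirrorE d x : mirror d (rev_ord x) =
  if d x is Some (y, b) then Some (rev_ord y, flip b) else None.
Proof. by rewrite ffunE rev_ordK. Qed.

Lemma mirror_some d x y b : mirror d x = Some (y, b) ->
  d (rev_ord x) = Some (rev_ord y, flip b).
Proof.
by rewrite ffunE; case: (d _) => [[z c]|] // [<- <-]; rewrite rev_ordK flipK.
Qed.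

Lemma mirror_none d x : mirror d x = None -> d (rev_ord x) = None.
Proof. by rewrite ffunE; case: (d _) => [[]|]. Qed.

Lemma rev_ord_lt x y : (rev_ord x < rev_ord y)%N = (y < x)%N.
Proof. by rewrite /=; have := ltn_ord x; have := ltn_ord y; lia. Qed.

Lemma mirror_diagram d : diagram d -> diagram (mirror d).
Proof.
move=> dg; split.
- move=> x y b /mirror_some E; have [h E'] := diag_sym dg E; split.
    by rewrite -(inj_eq rev_ord_inj).
  by rewrite ffunE E' rev_ordK flipK.
- move=> x x' y y' b b' /mirror_some E /mirror_some E'.
  rewrite -!(rev_ord_lt _ x) -!(rev_ord_lt _ y) -!(rev_ord_lt _ x') => h1 h2 h3.
  exact: diag_nc dg _ _ _ _ _ _ (diag_sym dg E').2 (diag_sym dg E).2 h3 h2 h1.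
- move=> x y b p /mirror_some E h1 h2 /mirror_none.
  by apply: (diag_np dg (diag_sym dg E).2); rewrite rev_ord_lt.
- move=> x y s p /mirror_some E h /mirror_none.
  by apply: (diag_edge dg E); case: (s) h; rewrite /= -rev_ord_lt.
- move=> x y s a c b /mirror_some E /mirror_some E' h1 h2.
  by apply: (diag_unc dg E (diag_sym dg E').2); rewrite rev_ord_lt.
Qed.

Lemma mirror_nprop d : nprop (mirror d) = nprop d.
Proof.
rewrite /nprop -(card_imset _ (@rev_ord_inj n)); apply: eq_card => x; rewrite inE.
apply/imsetP/eqP => [[y]|E]; first by rewrite inE => /eqP/mirror_none E ->.
by exists (rev_ord x); rewrite ?rev_ordK // inE mirrorE E.
Qed.

Lemma mirror_valid l d : valid l (mirror d) = valid l d.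
Proof.
suff H e : valid l e -> valid l (mirror e).
  by apply/idP/idP => /H; rewrite ?mirrorK.
case/validP => dg h; apply/validP; split; first exact: mirror_diagram.
by rewrite mirror_nprop.
Qed.

Lemma mirror_act_cup (k : fieldType) (dl0 dlL dlR kpL kpR : k) u v d :
  diagram d -> (u : nat) <> v ->
  act_cup dl0 dlR dlL kpR kpL (rev_ord v) (rev_ord u) (mirror d) =
  omap (fun cd => (cd.1, mirror cd.2)) (act_cup dl0 dlL dlR kpL kpR u v d).
Proof.
move=> dg nuv; rewrite /act_cup !mirrorE.
have nvu : (v == u) = false by apply/ord_neq/nesym.
have rI x y : (rev_ord x == rev_ord y) = (x == y) by rewrite (inj_eq rev_ord_inj).
have ext (f g : 'I_n -> option ('I_n * blob)) :
    (forall x, g (rev_ord x) = if f x is Some (y, b) then Some (rev_ord y, flip b) else None) ->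
    [ffun x => g x] = mirror [ffun x => f x].
  by move=> H; apply/ffunP => x; rewrite !ffunE -[x]rev_ordK H rev_ordK.
case Eu: (d u) => [[y b]|]; case Ev: (d v) => [[z b']|] //=.
- have [nyu Ey] := diag_sym dg Eu; have [nzv Ez] := diag_sym dg Ev.
  rewrite !rI; have -> : (z == u) = (y == v).
    apply/eqP/eqP => e; [rewrite e Eu in Ez|rewrite e Ev in Ey].
      by case: Ez.
    by case: Ey.
  case: eqP => [e|/eqP nyv].
    rewrite e Ev in Ey; case: Ey => _ ->.
    congr (Some (_, _)); first by case: (b) => [[]|].
    apply: ext => x; rewrite !rI mirrorE; have [->|] := eqVneq x v.
      by rewrite nvu.
    by case: (x == u).
  have nyz : y != z.
    apply/eqP => e; rewrite -e Ey in Ez; case: Ez => /esym e'.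
    by rewrite e' eqxx in nvu.
  have -> : join_blobs dlR dlL (flip b') (flip b) =
      omap (fun cb => (cb.1, flip cb.2)) (join_blobs dlL dlR b b').
    by case: (b) (b') => [[]|] [[]|].
  case: join_blobs => [[c bb]|] //=; congr (Some (_, _)).
  apply: ext => x; rewrite !rI mirrorE.
  have [->|_] := eqVneq x z; first by rewrite eq_sym (negPf nyz).
  have [//|_] := eqVneq x y.
  have [->|_] := eqVneq x v; first by rewrite nvu.
  by case: (x == u).
- have -> : (y == v) = false.
    by have [_ Ey] := diag_sym dg Eu; apply/eqP => e; rewrite e Ev in Ey.
  case: b Eu => [//|] Eu /=; congr (Some (_, _)).
  apply: ext => x; rewrite !rI mirrorE.
  have [//|_] := eqVneq x y.
  have [->|_] := eqVneq x v; first by rewrite nvu.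
  by case: (x == u).
- have [nzv Ez] := diag_sym dg Ev.
  have -> : (rev_ord z == rev_ord u) = false.
    by rewrite rI; apply/eqP => e; rewrite e Eu in Ez.
  case: b' Ev Ez => [//|] Ev Ez /=; congr (Some (_, _)).
  apply: ext => x; rewrite !rI mirrorE.
  have [//|_] := eqVneq x z.
  have [->|_] := eqVneq x v; first by rewrite nvu.
  by case: (x == u).
Qed.

Definition partner d x := if d x is Some (y, _) then y else x.

Lemma partner_inj d : diagram d -> injective (partner d).
Proof.
move=> dg x y; rewrite /partner.
case Ex: (d x) => [[x' b]|]; case Ey: (d y) => [[y' b']|] // e.
- by rewrite -e in Ey; apply: (diag_inj dg Ex Ey).
- by have [_] := diag_sym dg Ex; rewrite e Ey.
- by have [_] := diag_sym dg Ey; rewrite -e Ex.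
Qed.

Section MirrorWeights.
Variables (F : fieldType) (q Q1 Q2 : F) (sg : 'I_n -> F).

Lemma mirror_arc_hook x y b : (x < y)%N ->
  arc_hook n q Q2 Q1 (rev_ord y) (rev_ord x) (flip b) = arc_hook n q Q1 Q2 x y b.
Proof.
move=> h; have hx := ltn_ord x; have hy := ltn_ord y.
have e1 : (n - (rev_ord x).+1)%N = x by rewrite /=; lia.
have e2 : (n - (rev_ord y).+1)%N = y by rewrite /=; lia.
have e3 : (rev_ord x - rev_ord y)%N = (y - x)%N by rewrite /=; lia.
by case: b => [[]|]; rewrite /arc_hook [flip _]/= ?e1 ?e2 ?e3.
Qed.

(** An arc is weighed at its left end, which reflection exchanges with the right one; reindexing the
    product by the involution [partner] repairs this. *)
Lemma mirror_weight d : diagram d ->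
  weight q Q2 Q1 (sg \o @rev_ord n) (mirror d) = weight q Q1 Q2 sg d.
Proof.
move=> dg; congr _^-1; rewrite (reindex_inj rev_ord_inj) /=.
rewrite [RHS](reindex_inj (partner_inj dg)) /=; apply: eq_bigr => x _.
rewrite /hook mirrorE /partner; case Ex: (d x) => [[y b]|]; last first.
  by rewrite Ex /= rev_ordK.
have [_ ->] := diag_sym dg Ex; rewrite rev_ord_lt.
by case: ifP => // h; rewrite mirror_arc_hook.
Qed.

Lemma mirror_cup_coef u v d D : diagram D -> (u : nat) <> v ->
  cup_coef q Q2 Q1 (sg \o @rev_ord n) (rev_ord v) (rev_ord u) (mirror d) (mirror D)
  = cup_coef q Q1 Q2 sg u v d D.
Proof.
move=> dg nuv; rewrite /cup_coef mirror_act_cup //.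
case: act_cup => [[c D']|] //=; rewrite (inj_eq (inv_inj mirrorK)).
by rewrite mirror_weight.
Qed.

Lemma mirror_generic : generic q Q1 Q2 sg -> generic q Q2 Q1 (sg \o @rev_ord n).
Proof. by case=> ? ? ? ? ? ? ? sg0; split=> // x; apply: sg0. Qed.

End MirrorWeights.

Lemma mirror_ltype u v D : ltype (rev_ord v) (rev_ord u) (mirror D) = rtype u v D.
Proof.
rewrite /ltype /rtype !mirrorE; case: (D v) => [[y b]|] //.
by case: (D u) => [[z b']|]; rewrite /= ?rev_ord_lt //.
Qed.

Section RightSum.
Variables (F : fieldType) (q Q1 Q2 : F) (sg : 'I_n -> F).
Local Notation qi := (qint q).
Local Notation W1 := (qdown q Q1).
Local Notation W2 := (qdown q Q2).
Hypothesis G : generic q Q1 Q2 sg.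

Variant right_end d u v : F -> Prop :=
| RightFree (b : nat) of n = (v.+1 + 2 * b)%N & (forall x, (v < x)%N -> d x <> None)
    & uncovered d u : right_end d u v (qi b / qi b.+1)
| RightProp p (b : nat) of p = (v + 2 * b).+1 :> nat & d p = None & closed_on d v.+1 p
    & uncovered d u : right_end d u v ((qi b + sg p / sg u) / qi b.+1)
| RightParent y z bb (b : nat) of z = (v + 2 * b).+1 :> nat & d y = Some (z, bb)
    & (y < u)%N & closed_on d v.+1 z : right_end d u v (qi b / qi b.+1)
| RightBlob a of u = (2 * a)%N :> nat & (forall x, (x < u)%N -> d x <> None)
    & uncovered d u : right_end d u v (W1 a.+1 / W1 a).

Variables (l : nat) (d : HD n) (u v : 'I_n).
Hypotheses (vd : valid l d) (huv : v = u.+1 :> nat) (Eu : d u = Some (v, None)).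

Lemma mirror_closed i j : (j <= n)%N ->
  closed_on (mirror d) i j -> closed_on d (n - j) (n - i).
Proof.
move=> hj cl x hx; have hxn := ltn_ord x.
have [|y /mirror_some E hy] := cl (rev_ord x); first by rewrite /=; lia.
rewrite rev_ordK /= in E; exists (rev_ord y) => //.
by have := ltn_ord y; rewrite /=; lia.
Qed.

(** This is [left_sum] for the mirror image, with [Q1], [Q2] exchanged, the ends of the cup
    exchanged, and the signs composed with the reflection. *)
Lemma right_sum : exists2 val, right_end d u v val &
  \sum_(D | valid l D && rtype u v D) cup_coef q Q1 Q2 sg u v d D
  = weight q Q1 Q2 sg d * val.
Proof.
have [dg _] := validP _ _ vd; have Ev := (diag_sym dg Eu).2.
have hu := ltn_ord u; have hv := ltn_ord v.
have vm : valid l (mirror d) by rewrite mirror_valid.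
have hm : rev_ord u = (rev_ord v).+1 :> nat by rewrite /=; lia.
have Em : mirror d (rev_ord v) = Some (rev_ord u, None) by rewrite mirrorE Ev.
have [val Hval Hsum] := @left_sum n F q Q2 Q1 (sg \o @rev_ord n)
  (mirror_generic G) l (mirror d) (rev_ord v) (rev_ord u) vm hm Em.
exists val; last first.
  rewrite -(mirror_weight q Q1 Q2 sg dg) -Hsum.
  rewrite [RHS](reindex_inj (inv_inj mirrorK)) /=.
  apply: eq_big => [D|D /andP[vD _]]; first by rewrite mirror_valid mirror_ltype.
  by rewrite mirror_cup_coef //; [case/validP: vD|lia].
have unc : uncovered (mirror d) (rev_ord v) -> uncovered d u.
  move=> H a c b E h.
  have na : (a : nat) <> u.
    by move=> /val_inj e; move: E h; rewrite e Eu => -[<- _]; lia.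
  have nc : (c : nat) <> v.
    move=> /val_inj e; rewrite e in E; have := (diag_sym dg E).2.
    by rewrite Ev => -[e' _]; apply: na; rewrite e'.
  have [_ E'] := diag_sym dg E.
  apply: (H (rev_ord c) (rev_ord a) (flip b)); first by rewrite mirrorE E'.
  by rewrite !rev_ord_lt; lia.
have none x : d x = None -> mirror d (rev_ord x) = None by rewrite mirrorE => ->.
have hrv : (rev_ord v : nat) = (n - v.+1)%N by [].
have hru : (rev_ord u : nat) = (n - u.+1)%N by [].
case: Hval.
- move=> a ha np /unc un; apply: RightFree => //; first by lia.
  move=> x hx /none; apply: np; by rewrite rev_ord_lt.
- move=> p a ha /mirror_none Ep cl /unc un.
  have hp := ltn_ord p; have hrp : (rev_ord p : nat) = (n - p.+1)%N by [].
  rewrite [(sg \o _) p]/= [(sg \o _) _]/= rev_ordK.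
  apply: RightProp => //; first by lia.
  have := mirror_closed _ cl; rewrite hrp hrv => H.
  by have -> : v.+1 = (n - (n - v.+1))%N; [lia|apply: H; lia].
- move=> y z b a ha /mirror_some Ey hz cl.
  have hy := ltn_ord y; have hry : (rev_ord y : nat) = (n - y.+1)%N by [].
  have hzn := ltn_ord z; have hrz : (rev_ord z : nat) = (n - z.+1)%N by [].
  apply: (@RightParent d u v (rev_ord z) (rev_ord y) (flip b)); try lia.
    exact: (diag_sym dg Ey).2.
  have := mirror_closed _ cl; rewrite hry hrv => H.
  by have -> : v.+1 = (n - (n - v.+1))%N; [lia|apply: H; lia].
- move=> b hb np /unc un; apply: RightBlob => //; first by lia.
  move=> x hx /none; apply: np; by rewrite rev_ord_lt.
Qed.

End RightSum.
End Mirror.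

(** * The coefficient sums *)

Local Arguments arc_hook : simpl never.

Section CupSum.
Variables (n : nat) (F : fieldType) (q Q1 Q2 : F) (sg : 'I_n -> F).
Implicit Types (D : HD n) (x y z p : 'I_n) (b : blob).
Local Notation qi := (qint q).
Local Notation W1 := (qdown q Q1).
Local Notation W2 := (qdown q Q2).
Hypothesis G : generic q Q1 Q2 sg.
Local Notation q0 := (generic_q0 G).
Local Notation qq := (generic_qq G).
Local Notation Q10 := (generic_Q1 G).
Local Notation Q20 := (generic_Q2 G).
Local Notation qi0 := (generic_qint G).
Local Notation W10 := (generic_qdown1 G).
Local Notation W20 := (generic_qdown2 G).
Local Notation ahk := (arc_hook n q Q1 Q2).
Local Notation hk := (hook q Q1 Q2 sg).
Local Notation wt := (weight q Q1 Q2 sg).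
Local Notation cf := (cup_coef q Q1 Q2 sg).
Variables (l : nat) (d : HD n) (u v : 'I_n).
Hypotheses (vd : valid l d) (huv : v = u.+1 :> nat) (Eu : d u = Some (v, None)).

Let dg : diagram d. Proof. by case/validP: vd. Qed.
Let Ev : d v = Some (u, None). Proof. exact: (diag_sym dg Eu).2. Qed.
Let nuv : (u : nat) <> v. Proof. lia. Qed.

Definition loop_type D : bool := if D u is Some (y, _) then y == v else false.
Definition parent_type D : bool :=
  match D u, D v with Some (y, _), Some (z, _) => (y < u) && (v < z) | _, _ => false end%N.
Definition blob_at D x : blob := if D x is Some (_, b) then b else None.

Lemma cup_sum_split : \sum_(D | valid l D) cf u v d D =
  \sum_(D | valid l D && loop_type D) cf u v d D +
  \sum_(D | valid l D && ltype u v D) cf u v d D +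
  \sum_(D | valid l D && rtype u v D) cf u v d D +
  \sum_(D | valid l D && parent_type D) cf u v d D.
Proof.
rewrite ![\sum_(D | valid l D && _ D) _]big_mkcondr -!big_split /=.
apply: eq_bigr => D vD; have [->|/eqP nz] := eqVneq (cf u v d D) 0.
  by rewrite !if_same !addr0.
have [dgD _] := validP _ _ vD.
rewrite /loop_type /ltype /rtype /parent_type.
have [c _ []] := cup_coef_step vd huv vD nz.
- move=> b Du _; have Dv := (diag_sym dgD Du).2; rewrite Du Dv eqxx.
  have -> : (v < u)%N = false by lia.
  by rewrite /= !addr0.
- move=> y z b1 b2 _ bb Du Dv [? ? ? ? ?] _ _ _; rewrite Du Dv ord_neq //.
  have Dy := (diag_sym dgD Du).2; have Dz := (diag_sym dgD Dv).2.
  have Cy : (y < u)%N /\ (v < y)%N = false \/ (y < u)%N = false /\ (v < y)%N by lia.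
  have Cz : (z < u)%N /\ (v < z)%N = false \/ (z < u)%N = false /\ (v < z)%N by lia.
  case: Cy => -[h1 h2]; case: Cz => -[h3 h4];
    rewrite h1 h2 h3 h4 /= ?addr0 ?add0r //.
  (* The combination with [u] joined to the right and [v] to the left would be a crossing. *)
  by exfalso; have := diag_nc dgD Dz Du; lia.
- move=> y Du Dv [? ?] _ _; rewrite Du Dv ord_neq //.
  have Dy := (diag_sym dgD Du).2; have := diag_np dgD Du (p := v).
  case: (ltnP y u) => h /=; rewrite ?addr0 ?add0r //.
  by rewrite Dv => H; case: H => //; lia.
- move=> z Du Dv [? ?] _ _; rewrite Du Dv.
  have Dz := (diag_sym dgD Dv).2; have := diag_np dgD Dz (p := u).
  case: (ltnP v z) => h /=; rewrite ?addr0 ?add0r //.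
  by rewrite Du => H; case: H => //; lia.
Qed.

Let recolor_valid b : (forall s, b = Some s -> uncovered d u /\
    forall x, (if s then x < u else v < x)%N -> d x <> None) -> valid l (recolor d u v b).
Proof.
move=> H; apply/validP; split; last first.
  by rewrite (recolor_nprop _ dg Eu); case/validP: vd.
apply: (recolor_diagram dg Eu) => s hs; have [unc np] := H s hs.
  move=> p hp; have [->|nu] := eqVneq p u; first by rewrite Eu.
  have [->|nv] := eqVneq p v; first by rewrite Ev.
  by apply: np; move/neq_val: nu; move/neq_val: nv; case: (s) hp => /=; lia.
move=> a c b'' E /orP[|] h; apply: (unc _ _ _ E); first by [].
have na : (a : nat) <> u.
  by move=> /val_inj e; move: E h; rewrite e Eu => -[<- _]; lia.
lia.
Qed.

Let recolor_coef b : cf u v d (recolor d u v b) =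
  wt d * (loop_factor (- qi 2) (qbr q (Q1 * q)) (qbr q (Q2 * q)) b / ahk u v b).
Proof.
have rv : recolor d u v b v = Some (u, b) by rewrite recolorE // eqxx eq_sym ord_neq.
have ru : recolor d u v b u = Some (v, b) by rewrite recolorE // eqxx.
rewrite /cup_coef act_cup_recolor // eqxx (weight_agree G (s := [:: u; v]) (d := d)).
- rewrite !big_cons !big_nil (hook_cup G vd huv Eu) (hook_right _ _ _ _ Ev) ?(hook_arc _ _ _ _ ru);
    try lia.
  by rewrite (hook_right _ _ _ _ rv) ?mulr1 ?mul1r; [rewrite mulrCA|lia].
- by rewrite /= inE ord_neq.
- move=> x; rewrite !inE negb_or => /andP[/negPf h1 /negPf h2].
  by rewrite recolorE // h1 h2.
Qed.

Lemma loop_sum_blob b : \sum_(D | valid l D && (loop_type D && (blob_at D u == b)))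
    cf u v d D =
  if valid l (recolor d u v b) then wt d *
    (loop_factor (- qi 2) (qbr q (Q1 * q)) (qbr q (Q2 * q)) b / ahk u v b) else 0.
Proof.
have uniq D : valid l D -> loop_type D && (blob_at D u == b) -> cf u v d D <> 0 ->
    D = recolor d u v b.
  move=> vD /andP[lt /eqP hb] nz; move: lt hb; rewrite /loop_type /blob_at.
  have [c _ []] := cup_coef_step vd huv vD nz.
  - by move=> b' -> ED _ <-.
  - by move=> y z b1 b2 c' bb -> _ [_ h _ _ _]; rewrite ord_neq.
  - by move=> y -> _ [_ h]; rewrite ord_neq.
  - by move=> z ->.
case: ifP => vr.
  rewrite (sum_cup_one (D0 := recolor d u v b)) ?recolor_coef //.
  by rewrite /loop_type /blob_at recolorE // eqxx !eqxx.
by apply: sum_cup_none => D vD h nz; have e := uniq D vD h nz; rewrite e vr in vD.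
Qed.

Lemma sum_blob (f : blob -> F) :
  \sum_b f b = f None + f (Some true) + f (Some false).
Proof.
rewrite (bigD1 None) //= (bigD1 (Some true)) //= (bigD1 (Some false)) //=.
by rewrite big1 ?addr0 ?addrA // => -[[]|].
Qed.

(** The term [- qi 2] comes from [d] itself; a blobbed loop contributes only if the cup is exposed
    to the corresponding edge. *)
Lemma loop_sum : \sum_(D | valid l D && loop_type D) cf u v d D = wt d *
  (- qi 2
   + (if valid l (recolor d u v (Some true)) then
        qbr q (Q1 * q) / ahk u v (Some true) else 0)
   + (if valid l (recolor d u v (Some false)) then
        qbr q (Q2 * q) / ahk u v (Some false) else 0)).
Proof.
rewrite (partition_big (fun D => blob_at D u) predT) //=.
under eq_bigr => b _ do under eq_bigl => D do rewrite -andbA.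
under eq_bigr => b _ do rewrite loop_sum_blob.
rewrite sum_blob recolor_id // vd !mulrDr.
have -> : ahk u v None = 1.
  by rewrite -(hook_arc q Q1 Q2 sg Eu) ?(hook_cup G vd huv Eu) //; lia.
by rewrite divr1; do 2 case: ifP; rewrite ?mulr0.
Qed.

Lemma cup_hook_left a : u = (2 * a)%N :> nat -> ahk u v (Some true) = qi a.+1 * W1 a.
Proof.
move=> h; rewrite /arc_hook.
have -> : (v.+1)./2 = a.+1 by lia.
by have -> : u./2 = a by lia.
Qed.

Lemma cup_hook_right (b : nat) : n = (v.+1 + 2 * b)%N -> ahk u v (Some false) = qi b.+1 * W2 b.
Proof.
move=> h; rewrite /arc_hook.
have -> : ((n - u.+1).+1)./2 = b.+1 by lia.
by have -> : (n - v.+1)./2 = b by lia.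
Qed.

Lemma recolor_left : uncovered d u -> (forall x, (x < u)%N -> d x <> None) ->
  valid l (recolor d u v (Some true)).
Proof. by move=> unc np; apply: recolor_valid => s [<-]. Qed.

Lemma recolor_right : uncovered d u -> (forall x, (v < x)%N -> d x <> None) ->
  valid l (recolor d u v (Some false)).
Proof. by move=> unc np; apply: recolor_valid => s [<-]. Qed.

Lemma recolor_blocked s x : d x = None -> (if s then x < u else v < x)%N ->
  valid l (recolor d u v (Some s)) = false.
Proof.
move=> Ex h; apply/negP => /validP[dgr _].
have rx : recolor d u v (Some s) x = None.
  rewrite recolorE //; case: eqP => [e|_]; first by rewrite e Eu in Ex.
  by case: eqP => [e|_] //; rewrite e Ev in Ex.
have ru : recolor d u v (Some s) u = Some (v, Some s) by rewrite recolorE // eqxx.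
by apply: (diag_edge dgr ru) rx; case: (s) h => /=; lia.
Qed.

Lemma recolor_covered s a c b : d a = Some (c, b) -> (a < u < c)%N ->
  valid l (recolor d u v (Some s)) = false.
Proof.
move=> Ea h; apply/negP => /validP[dgr _].
have ru : recolor d u v (Some s) u = Some (v, Some s) by rewrite recolorE // eqxx.
have ra : recolor d u v (Some s) a = Some (c, b).
  rewrite recolorE // !ord_neq //; last by lia.
  move=> /val_inj e; move: h; rewrite e Ev in Ea.
  by case: Ea => <- _; lia.
by have := diag_unc dgr ru ra; lia.
Qed.

Lemma parent_contrib_arc D : valid l D -> parent_type D -> cf u v d D <> 0 ->
  exists y z b1 b2 c bb, [/\ cf u v d D = c * wt D, D u = Some (y, b1),
    D v = Some (z, b2), (y < u < z)%N &
    [/\ d y = Some (z, bb), join_blobs (- W1 0) (- W2 0) b1 b2 = Some (c, bb) &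
     D = splice d u v (Some (y, b1)) (Some (z, b2))]].
Proof.
move=> vD lt nz; move: lt; rewrite /parent_type.
have [c e st] := cup_coef_step vd huv vD nz; case: st e.
- move=> b -> _ _; case: (D v) => [[z b']|] // /andP[h _]; exfalso; lia.
- move=> y z b1 b2 c' bb E1 E2 _ J Ey ED e; rewrite E1 E2 => h.
  by exists y, z, b1, b2, c', bb; split=> //; lia.
- by move=> y -> ->.
- by move=> z ->.
Qed.

Lemma parent_sum0 : uncovered d u ->
  \sum_(D | valid l D && parent_type D) cf u v d D = 0.
Proof.
move=> unc; apply: sum_cup_none => D vD pt nz.
have [y [z [b1 [b2 [c [bb [_ _ _ h [E _ _]]]]]]]] := parent_contrib_arc vD pt nz.
exact: unc E h.
Qed.

Section Parent.
Variables (y z : 'I_n) (bb : blob) (a b : nat).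
Hypotheses (Ey : d y = Some (z, bb)) (hy : u = (y + 2 * a).+1 :> nat).
Hypotheses (hz : z = (v + 2 * b).+1 :> nat).
Hypotheses (cly : closed_on d y.+1 u) (clz : closed_on d v.+1 z).

Let open b1 b2 := splice d u v (Some (y, b1)) (Some (z, b2)).
Let Ez : d z = Some (y, bb). Proof. exact: (diag_sym dg Ey).2. Qed.
Let hyu : (y < u)%N. Proof. lia. Qed.
Let hvz : ((z < y) || (v < z))%N. Proof. lia. Qed.

Let open_valid b1 b2 c : join_blobs (- W1 0) (- W2 0) b1 b2 = Some (c, bb) ->
  valid l (open b1 b2).
Proof.
move=> J; apply/validP; split; last first.
  by rewrite (open_nprop b1 b2 dg huv Eu Ey); [case/validP: vd|lia|lia].
have hb : (forall s, b1 = Some s -> bb = Some s) /\ (forall s, b2 = Some s -> bb = Some s).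
  by case: b1 b2 J => [[]|] [[]|] //= [_ <-]; split.
have inside p p' c' : (y < p < u)%N || (v < p < z)%N -> d p = Some (p', c') ->
    c' = None /\ ((y < p < u)%N && (y < p' < u)%N || (v < p < z)%N && (v < p' < z)%N).
  case/orP => h E; [have [p'' E' h'] := cly h|have [p'' E' h'] := clz h];
    by rewrite E in E'; case: E' h' => -> <- h'; rewrite ?h ?h' ?orbT.
have none p : (y < p < u)%N || (v < p < z)%N -> d p <> None.
  by case/orP => h; [have [p' ->] := cly h|have [p' ->] := clz h].
apply: (open_diagram (bb := bb)) => //.
- move=> p p' c' E hp npy npz.
  have E' := (diag_sym dg E).2.
  have H1 := inside p p' c' ^~ E; have H2 := inside p' p c' ^~ E'.
  have n1 : (p : nat) <> y by move=> /val_inj.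
  have n2 : (p' : nat) <> y.
    by move=> /val_inj e; apply: npz; rewrite e Ey in E'; case: E'.
  have n3 : (p' : nat) <> u.
    by move=> /val_inj e; rewrite e Eu in E'; case: E' => e'; move: hp; rewrite -e' e; lia.
  have K1 : (y < p < u)%N -> (y < p' < u)%N.
    by move=> h; have := H1; rewrite h /= => -[//|_]; lia.
  have K2 : (y < p' < u)%N -> (y < p < u)%N.
    by move=> h; have := H2; rewrite h /= => -[//|_]; lia.
  lia.
- by move=> p hp; apply: none; lia.
- move=> p p' s hp E; have [] : False; suff [] : Some s = None :> blob by [].
  by apply: (inside p p' _ _ E).1; lia.
- by move=> s /hb.1 ->; split=> //; lia.
- by move=> s /hb.2.
Qed.

Let open_coef b1 b2 c : join_blobs (- W1 0) (- W2 0) b1 b2 = Some (c, bb) ->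
  cf u v d (open b1 b2) = wt d * (c * ahk y z bb / (ahk y u b1 * ahk v z b2)).
Proof.
move=> J; have [Du Dv Dy Dz] := open_at b1 b2 dg huv Ey hyu hvz.
rewrite /cup_coef (@act_cup_arcs _ F _ _ _ _ _ u v d y z b1 b2 bb c dg Eu Ey) //; try lia.
rewrite eqxx (weight_agree G (s := [:: u; v; y; z]) (d := d)); first last.
- move=> x; rewrite !inE !negb_or => /and4P[/neq_val ? /neq_val ? /neq_val ? /neq_val ?].
  by rewrite splice_far.
- by rewrite /= !inE !ord_neq //; lia.
rewrite !big_cons !big_nil (hook_cup G vd huv Eu) (hook_right _ _ _ _ Ev); last by lia.
rewrite (hook_arc _ _ _ _ Ey) ?(hook_right _ _ _ _ Ez); try lia.
rewrite (hook_right _ _ _ _ Du) ?(hook_arc _ _ _ _ Dv) ?(hook_arc _ _ _ _ Dy)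
  ?(hook_right _ _ _ _ Dz); try lia.
rewrite !mul1r !mulr1 mulrCA; congr (_ * _); rewrite mulrA; congr (_ / _); exact: mulrC.
Qed.

(** Only the innermost surrounding arc can be cut: a partner of [u] further out would cross
    [(y, z)], and one further in lies in a closed window and is not joined beyond the cup. *)
Lemma parent_unique D : valid l D -> parent_type D -> cf u v d D <> 0 ->
  exists b1 b2 c, [/\ D = open b1 b2, blob_at D u = b1, blob_at D v = b2 &
    join_blobs (- W1 0) (- W2 0) b1 b2 = Some (c, bb)].
Proof.
move=> vD pt nz; have [dgD _] := validP _ _ vD.
have [y' [z' [b1 [b2 [c [b' [_ Du Dv h [E J ED]]]]]]]] := parent_contrib_arc vD pt nz.
have yy : y' = y.
  apply: val_inj; case: (ltngtP y' y) => // hh.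
    have nz' : (y : nat) <> z'.
      by lia.
    have nzz' : (z : nat) <> z'.
      move=> /val_inj e; rewrite -e in E; have := diag_inj dg Ey E => e'.
      by move: hh; rewrite e' ltnn.
    have Dy : D y = Some (z, bb) by rewrite ED splice_far //; lia.
    by have := diag_nc dgD (diag_sym dgD Du).2 Dy; lia.
  have [|y'' E' h'] := cly (x := y'); first by lia.
  by move: h'; rewrite E in E'; case: E' => <- _; lia.
rewrite yy Ey in E; case: E => zz bb'; rewrite -zz -bb' yy in ED J.
by exists b1, b2, c; split=> //; rewrite /blob_at ?Du ?Dv.
Qed.

Lemma parent_sum_blob b1 b2 :
  \sum_(D | valid l D && (parent_type D && ((blob_at D u, blob_at D v) == (b1, b2))))
    cf u v d D =
  if join_blobs (- W1 0) (- W2 0) b1 b2 is Some (c, b') then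
    if b' == bb then wt d * (c * ahk y z bb / (ahk y u b1 * ahk v z b2)) else 0
  else 0.
Proof.
have uniq D : valid l D -> parent_type D && ((blob_at D u, blob_at D v) == (b1, b2)) ->
    cf u v d D <> 0 ->
    D = open b1 b2 /\ exists c, join_blobs (- W1 0) (- W2 0) b1 b2 = Some (c, bb).
  move=> vD /andP[pt /eqP[e1 e2]] nz.
  have [b1' [b2' [c [eD e1' e2' J]]]] := parent_unique vD pt nz.
  by rewrite e1 in e1'; rewrite e2 in e2'; subst b1' b2'; split=> //; exists c.
case J: (join_blobs _ _ _ _) => [[c b']|]; last first.
  by apply: sum_cup_none => D vD h nz; have [_ [c]] := uniq D vD h nz; rewrite J.
case: eqP => [e|ne]; last first.
  by apply: sum_cup_none => D vD h nz; have [_ [c']] := uniq D vD h nz; rewrite J => -[].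
rewrite e in J; rewrite (sum_cup_one (D0 := open b1 b2)) ?(open_coef J) //.
- exact: open_valid J.
- have [Du Dv _ _] := open_at b1 b2 dg huv Ey hyu hvz.
  by rewrite /parent_type /blob_at Du Dv eqxx andbT; lia.
- by move=> D vD h nz; have [] := uniq D vD h nz.
Qed.

Lemma parent_sum : \sum_(D | valid l D && parent_type D) cf u v d D =
  \sum_(b1 : blob) \sum_(b2 : blob)
    if join_blobs (- W1 0) (- W2 0) b1 b2 is Some (c, b') then
      if b' == bb then wt d * (c * ahk y z bb / (ahk y u b1 * ahk v z b2)) else 0
    else 0.
Proof.
rewrite pair_bigA /=.
rewrite (partition_big (fun D => (blob_at D u, blob_at D v)) predT) //=.
apply: eq_bigr => -[b1 b2] _ /=; rewrite -parent_sum_blob.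
by apply: eq_bigl => D; rewrite -andbA.
Qed.

(** Cutting the surrounding arc cancels exactly the plain loop and the two chains that this arc
    stops. Its blob decides the identity: [qint_parent] without one, [qint_blobbed] with one. *)
Lemma parent_total : \sum_(D | valid l D && parent_type D) cf u v d D =
  - (wt d * (- qi 2 + qi a / qi a.+1 + qi b / qi b.+1)).
Proof.
have hyn := ltn_ord y; have hzn := ltn_ord z.
rewrite parent_sum !sum_blob /=.
have qa : qi a.+1 != 0 by rewrite qi0.
have qb : qi b.+1 != 0 by rewrite qi0.
have hab : qi (a + b).+2 != 0 by rewrite qi0.
case: bb Ey Ez => [[]|] Ey' Ez' /=; rewrite ?addr0 ?add0r /arc_hook.
- have [c hc] : exists c, y = (2 * c)%N :> nat.
    have [||c ->] := @closed_even _ d 0 y dg; last by exists c.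
      move=> x hx; case E: (d x) => [[x' bx]|]; last first.
        by exfalso; apply: (diag_edge dg Ey' _ E); lia.
      exists x', bx; split=> //; case: (ltnP x' y) => // h.
      have nx : (x' : nat) <> y.
        move=> /val_inj e; rewrite e in E; have := (diag_sym dg E).2.
        by rewrite Ey' => -[e' _]; move: hx; rewrite -e'; lia.
      by exfalso; apply: (diag_unc dg Ey' E); lia.
    by lia.
  have -> : (z.+1)./2 = (c + (a + b)).+2 by lia.
  have -> : y./2 = c by lia.
  have -> : (u.+1)./2 = (c + a).+1 by lia.
  have -> : v./2 = (c + a.+1)%N by lia.
  have -> : ((z - v).+1)./2 = b.+1 by lia.
  have -> : ((u - y).+1)./2 = a.+1 by lia.
  have h3 : qi (c + a).+1 != 0 by rewrite qi0.
  have h4 : qi (c + (a + b)).+2 != 0 by rewrite qi0.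
  have := qint_blobbed q0 qq Q10 qa qb h3 h4 (W10 c) (W10 (c + a.+1)).
  set t := (- qi 2 + _ + _).
  set A := qi a.+1 in qa *; set B := qi b.+1 in qb *; set C := qi (c + a).+1 in h3 *.
  set E := qi (c + (a + b)).+2 in h4 *.
  have := W10 c; have := W10 (c + a.+1)%N.
  set w := W1 c; set w' := W1 (c + a.+1)%N; set w0 := W1 0 => w'0 w0' H.
  (* The identity is solved for [t]; [E * w] is the hook of the surrounding arc. *)
  have {}H : t = - ((C * w * B)^-1 + (A * (E * w'))^-1 - w0 / (C * w * (E * w'))) * (E * w).
    apply/eqP; rewrite -subr_eq0; apply/eqP.
    rewrite -[RHS](mul0r (E * w)) -H; field.
    by rewrite ?qa ?qb ?h3 ?h4 ?w'0 ?w0'.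
  rewrite H; field; by rewrite ?qa ?qb ?h3 ?h4 ?w'0 ?w0'.
- have [c hc] : exists c, n = (z.+1 + 2 * c)%N :> nat.
    have [||c E] := @closed_even _ d z.+1 n dg; last by exists c.
      move=> x hx; case E: (d x) => [[x' bx]|]; last first.
        by exfalso; apply: (diag_edge dg Ez' _ E); lia.
      exists x', bx; split=> //; rewrite ltn_ord andbT; case: (ltnP z x') => // h.
      have E' := (diag_sym dg E).2.
      have nx : (x' : nat) <> z.
        move=> /val_inj e; rewrite e Ez' in E'.
        by case: E' => e' _; move: hx; rewrite -e'; lia.
      by exfalso; apply: (diag_unc dg Ez' E'); lia.
    by lia.
  have -> : ((n - y.+1).+1)./2 = (c + (b + a)).+2 by lia.
  have -> : (n - z.+1)./2 = c by lia.
  have -> : ((n - v.+1).+1)./2 = (c + b).+1 by lia.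
  have -> : (n - u.+1)./2 = (c + b.+1)%N by lia.
  have -> : ((z - v).+1)./2 = b.+1 by lia.
  have -> : ((u - y).+1)./2 = a.+1 by lia.
  have h3 : qi (c + b).+1 != 0 by rewrite qi0.
  have h4 : qi (c + (b + a)).+2 != 0 by rewrite qi0.
  have := qint_blobbed q0 qq Q20 qb qa h3 h4 (W20 c) (W20 (c + b.+1)).
  (* For a right blob the roles of [a] and [b] are exchanged in [qint_blobbed]. *)
  rewrite [- qi 2 + qi a / _ + _]addrAC.
  set t := (- qi 2 + _ + _).
  set A := qi a.+1 in qa *; set B := qi b.+1 in qb *; set C := qi (c + b).+1 in h3 *.
  set E := qi (c + (b + a)).+2 in h4 *.
  have := W20 c; have := W20 (c + b.+1)%N.
  set w := W2 c; set w' := W2 (c + b.+1)%N; set w0 := W2 0 => w'0 w0' H.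
  have {}H : t = - ((C * w * A)^-1 + (B * (E * w'))^-1 - w0 / (C * w * (E * w'))) * (E * w).
    apply/eqP; rewrite -subr_eq0; apply/eqP.
    rewrite -[RHS](mul0r (E * w)) -H; field.
    by rewrite ?qa ?qb ?h3 ?h4 ?w'0 ?w0'.
  rewrite H; field; by rewrite ?qa ?qb ?h3 ?h4 ?w'0 ?w0'.
- rewrite (qint_parent q0 qq) //.
  have -> : ((z - y).+1)./2 = (a + b).+2 by lia.
  have -> : ((z - v).+1)./2 = b.+1 by lia.
  have -> : ((u - y).+1)./2 = a.+1 by lia.
  by field; rewrite qa qb.
Qed.

End Parent.

Definition left_prop p (a : nat) : Prop :=
  [/\ u = (p + 2 * a).+1 :> nat, d p = None & closed_on d p.+1 u].
Definition right_prop p (b : nat) : Prop :=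
  [/\ p = (v + 2 * b).+1 :> nat, d p = None & closed_on d v.+1 p].

(** The suffix tells on which sides a chain stops at a propagating line. If only one side does, the
    other is free up to its edge, and its chain combines with both loops through [qint_loop]. *)
Variant cup_total : F -> Prop :=
| CupTotal0 : cup_total 0
| CupTotalLR p a p' (b : nat) of left_prop p a & right_prop p' b & uncovered d u :
    cup_total (- qi 2 + (qi a + sg p / sg v) / qi a.+1
                      + (qi b + sg p' / sg u) / qi b.+1)
| CupTotalR c p (b : nat) of right_prop p b & uncovered d u :
    cup_total (- (W1 c.+1 / W1 c) + (qi b + sg p / sg u) / qi b.+1)
| CupTotalL c p a of left_prop p a & uncovered d u :
    cup_total (- (W2 c.+1 / W2 c) + (qi a + sg p / sg v) / qi a.+1).

(** A propagating line exists, so the two sides cannot both be free. A surrounding arc stops both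
    chains and gives [0]; a chain ending at an arc blobbed towards the opposite edge cancels the
    free side, again giving [0]. *)
Lemma cup_sum p0 : d p0 = None -> exists2 t, cup_total t &
  \sum_(D | valid l D) cf u v d D = wt d * t.
Proof.
move=> Ep0; have nu : (p0 : nat) <> u by move=> /val_inj e; rewrite e Eu in Ep0.
have nv : (p0 : nat) <> v by move=> /val_inj e; rewrite e Ev in Ep0.
have side (P : Prop) : ((p0 < u)%N -> P) -> ((v < p0)%N -> P) -> P.
  by move=> h1 h2; have [/h1|/h2] : (p0 < u)%N \/ (v < p0)%N by lia.
rewrite cup_sum_split loop_sum.
have [vl Hl ->] := left_sum G vd huv Eu; have [vr Hr ->] := right_sum G vd huv Eu.
have cov : (exists a c b, d a = Some (c, b) /\ (a < u < c)%N) -> ~ uncovered d u.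
  by move=> [a [c [b [E h]]]] H; apply: H E h.
case: Hl => [a ha npl unc|p a hp Ep clp unc|y z b a hy Ey hvz cl|b hb npr unc].
- have rl := recolor_left unc npl.
  case: Hr => [b hb npr _|p b hp Ep clp _|y z b' b hz E h _|a' ha' _ _].
  + by apply: side => h; [case: (npl _ h)|case: (npr _ h)].
  + exists (- (W1 a.+1 / W1 a) + (qi b + sg p / sg u) / qi b.+1).
      exact: CupTotalR.
    rewrite rl (recolor_blocked (x := p)) // ?parent_sum0 // ?addr0; last by lia.
    rewrite (cup_hook_left ha) -(qint_loop q0 qq Q10 (a := a)) ?qi0 ?W10 // -!mulrDr.
    congr (_ * _); ring.
  + by case: (cov _ unc); exists y, z, b'; split=> //; lia.
  + exists 0; first exact: CupTotal0.
    have -> : a' = a by lia.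
    have rr : valid l (recolor d u v (Some false)) = false.
      by apply: (recolor_blocked (x := p0)) => //; apply: side => // h; case: (npl _ h).
    rewrite rl rr parent_sum0 // !addr0 (cup_hook_left ha) -!mulrDr; congr (_ * _).
    rewrite [X in X + _]addrAC (qint_loop q0 qq Q10) ?qi0 ?W10 //.
    by rewrite addNr.
- case: Hr => [b hb npr _|p' b hp' Ep' clp' _|y z b' b hz E h _|a' ha' npl _].
  + have rr := recolor_right unc npr.
    exists (- (W2 b.+1 / W2 b) + (qi a + sg p / sg v) / qi a.+1).
      exact: CupTotalL.
    rewrite rr (recolor_blocked (x := p)) // ?parent_sum0 // ?addr0; last by lia.
    rewrite (cup_hook_right hb) -(qint_loop q0 qq Q20 (a := b)) ?qi0 ?W20 // -!mulrDr.
    congr (_ * _); ring.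
  + exists (- qi 2 + (qi a + sg p / sg v) / qi a.+1 + (qi b + sg p' / sg u) / qi b.+1).
      exact: CupTotalLR.
    rewrite (recolor_blocked (x := p)) ?(recolor_blocked (x := p')) //; try lia.
    by rewrite parent_sum0 // !addr0 -!mulrDr.
  + by case: (cov _ unc); exists y, z, b'; split=> //; lia.
  + by case: (npl p) => //; lia.
- have hyu : (y < u)%N by lia.
  have cov' : ~ uncovered d u by apply: cov; exists y, z, b; split=> //; lia.
  case: Hr => [? _ _ /cov' []|? ? _ _ _ /cov' []|y' z' b' b2 hz' Ey' hyu' cl'|? _ _ /cov' []].
  have Ez := (diag_sym dg Ey).2; have Ez' := (diag_sym dg Ey').2.
  have h1 : (z' <= z)%N.
    case: (leqP z' z) => // h; have [|x E hx] := cl' z; first by lia.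
    by move: hx; rewrite Ez in E; case: E => <- _; lia.
  have h2 : (y' <= y)%N.
    case: (leqP y' y) => // h; have [|x E hx] := cl y'; first by lia.
    by move: hx; rewrite Ey' in E; case: E => <- _; lia.
  have zz : z' = z.
    apply: val_inj; case: (ltngtP z' z) => // h; last by lia.
    have nyy : (y' : nat) <> y.
      by move=> /val_inj e; move: Ey' h; rewrite e Ey => -[-> _]; rewrite ltnn.
    by have := diag_nc dg Ey' Ey; lia.
  rewrite zz in hz' cl'.
  exists 0; first exact: CupTotal0.
  rewrite !(recolor_covered _ Ey); try lia.
  rewrite (parent_total Ey hy hz' cl cl') !addr0 -!mulrDr mulr0.
  by rewrite subrr.
- case: Hr => [b' hb' _ _|p b' hp Ep clp _|y z b' b2 hz E h _|a ha npl _].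
  + exists 0; first exact: CupTotal0.
    have -> : b' = b by lia.
    have rr := recolor_right unc npr.
    have rl : valid l (recolor d u v (Some true)) = false.
      by apply: (recolor_blocked (x := p0)) => //; apply: side => // h; case: (npr _ h).
    rewrite rl rr parent_sum0 // !addr0 (cup_hook_right hb) -!mulrDr; congr (_ * _).
    have := qint_loop q0 qq Q20 (a := b); rewrite !qi0 // W20 => /(_ isT isT) H.
    have -> : W2 b.+1 / W2 b = - (- qi 2 + qi b / qi b.+1 +
       qbr q (Q2 * q) / (qi b.+1 * W2 b)) by rewrite H opprK.
    ring.
  + by case: (npr p) => //; lia.
  + by case: (cov _ unc); exists y, z, b'; split=> //; lia.
  + by apply: side => h; [case: (npl _ h)|case: (npr _ h)].
Qed.

End CupSum.

(** * The blob generators *)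

Section BlobSum.
Variables (n : nat) (F : fieldType) (q Q1 Q2 : F) (sg : 'I_n -> F).
Implicit Types (d D : HD n) (x y z p : 'I_n).
Local Notation qi := (qint q).
Local Notation W1 := (qdown q Q1).
Local Notation W2 := (qdown q Q2).
Hypothesis G : generic q Q1 Q2 sg.
Local Notation ahk := (arc_hook n q Q1 Q2).
Local Notation wt := (weight q Q1 Q2 sg).

Definition blob_coef (s : bool) p d D : F :=
  if act_blob (- W1 0) (- W2 0) s p D is Some (c, D'') then
    if D'' == d then c * wt D else 0 else 0.

Lemma act_blobP s p D c d : diagram D ->
  act_blob (- W1 0) (- W2 0) s p D = Some (c, d) ->
  exists2 y, d p = Some (y, Some s) & D = d \/ D = recolor d p y None.
Proof.
move=> dg; rewrite /act_blob; case E: (D p) => [[y [s'|]]|] //.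
  by case: eqP => // <- [_ <-]; exists y; [rewrite E|left].
move=> [_ <-]; have [nyp Ey] := diag_sym dg E.
have yp : (p == y) = false by rewrite eq_sym (negPf nyp).
exists y; first by rewrite ffunE eqxx.
right; apply/ffunP => x; rewrite !ffunE.
have [->|nx] := eqVneq x p; first by rewrite E.
by have [->|ny] := eqVneq x y; first by rewrite Ey.
Qed.

(** If the arc at [p] carries the blob, its two preimages are [d], with constant [-[w]], and [d]
    without the blob, with constant [1]. At the extreme vertex the ratio of the two hooks is exactly
    [[w]]. *)
Lemma blob_sum l s p d : valid l d -> (p : nat) = (if s then 0 else n.-1)%N ->
  \sum_(D | valid l D) blob_coef s p d D = 0.
Proof.
move=> vd hp; have [dg nd] := validP _ _ vd.
have [|none] := boolP (if d p is Some (_, Some s') then s' == s else false); last first.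
  apply: big1 => D vD; rewrite /blob_coef; case E: act_blob => [[c D']|] //.
  case: eqP => // e; rewrite e in E; have [dgD _] := validP _ _ vD.
  by have [y Ey _] := act_blobP dgD E; rewrite Ey eqxx in none.
case Ep: (d p) => [[y [s'|]]|] // /eqP e; rewrite e in Ep.
have npy := diag_neq dg Ep; have Ey := (diag_sym dg Ep).2.
pose D0 := recolor d p y None.
have D0p : D0 p = Some (y, None) by rewrite recolorE // eqxx.
have D0y : D0 y = Some (p, None) by rewrite recolorE // eqxx ord_neq //; apply: nesym.
have vD0 : valid l D0.
  by apply/validP; split; [apply: (recolor_diagram dg Ep)|rewrite (recolor_nprop _ dg Ep)].
have nD0 : D0 != d by apply/eqP => e'; rewrite e' Ep in D0p.
rewrite (bigD1 d) //= (bigD1 D0) /=; last by rewrite vD0.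
rewrite big1 ?addr0; last first.
  move=> D /andP[/andP[vD /eqP n1] /eqP n2]; rewrite /blob_coef.
  case E: act_blob => [[c D']|] //; case: eqP => // e'; rewrite e' in E.
  have [dgD _] := validP _ _ vD; have [z Ez] := act_blobP dgD E.
  by rewrite Ep in Ez; case: Ez => <- [].
rewrite /blob_coef /act_blob Ep D0p eqxx eqxx.
have -> : [ffun x => if x == p then Some (y, Some s)
            else if x == y then Some (p, Some s) else D0 x] = d.
  apply/ffunP => x; rewrite ffunE; case: eqP => [->|n1]; first by rewrite Ep.
  case: eqP => [->|n2]; first by rewrite Ey.
  by rewrite /D0 recolorE //; case: eqP => // _; case: eqP.
rewrite eqxx mul1r (weight_agree G (s := [:: p; y]) (d := d) (D := D0)); first last.
- move=> x; rewrite !inE negb_or => /andP[/negPf h1 /negPf h2].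
  by rewrite /D0 recolorE // h1 h2.
- by rewrite /= inE ord_neq.
rewrite !big_cons !big_nil.
have hpn := ltn_ord p; have hyn := ltn_ord y.
move: hp Ep Ey; clear e; case: s => hp Ep Ey.
  have h : (p < y)%N by lia.
  rewrite (hook_arc _ _ _ _ Ep) // (hook_arc _ _ _ _ D0p) //.
  rewrite (hook_right _ _ _ _ Ey) // (hook_right _ _ _ _ D0y) // !mulr1 /arc_hook.
  have -> : p./2 = 0%N by rewrite hp.
  have -> : (y - p)%N = y by lia.
  rewrite mulrAC divff ?mul1r; last by apply: (generic_qint G); lia.
  by ring.
have h : (y < p)%N by lia.
rewrite (hook_arc _ _ _ _ Ey) // (hook_arc _ _ _ _ D0y) //.
rewrite (hook_right _ _ _ _ Ep) // (hook_right _ _ _ _ D0p) // !mulr1 !mul1r /arc_hook.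
have -> : (n - p.+1)./2 = 0%N by lia.
have -> : (n - y.+1)%N = (p - y)%N by lia.
rewrite mulrAC divff ?mul1r; last by apply: (generic_qint G); lia.
by ring.
Qed.

End BlobSum.

(** * Specialisation at a root of unity *)

Section Specialisation.
Variables (k : fieldType) (P : 'I_3 -> k).
Local Notation K := {fraction {mpoly k[3]}}.
Local Notation spec h c := (spec_at h P c).
Implicit Types (f g : K) (a b : k).

Let M0 (M : {mpoly k[3]}) : M.@[P] != 0 -> FracField.tofrac M != 0.
Proof. by move=> h; rewrite tofrac_eq0; apply: contraNneq h => ->; rewrite meval0. Qed.

Lemma spec_poly (N : {mpoly k[3]}) : spec (FracField.tofrac N) N.@[P].
Proof.
exists N, 1; rewrite meval1; split; first exact: oner_neq0.
  by rewrite rmorph1 divr1.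
by rewrite divr1.
Qed.

Lemma spec1 : spec 1 1.
Proof. by have := spec_poly 1; rewrite meval1 rmorph1. Qed.

Lemma spec0 : spec 0 0.
Proof. by have := spec_poly 0; rewrite meval0 rmorph0. Qed.

Lemma specN f a : spec f a -> spec (- f) (- a).
Proof.
case=> N [M [h -> ->]]; exists (- N), M; split=> //.
  by rewrite rmorphN mulNr.
by rewrite mevalN mulNr.
Qed.

Lemma specD f g a b : spec f a -> spec g b -> spec (f + g) (a + b).
Proof.
case=> N [M [h -> ->]] [N' [M' [h' -> ->]]]; exists (N * M' + N' * M), (M * M').
split; first by rewrite mevalM mulf_neq0.
  by rewrite rmorphD !rmorphM addf_div ?M0.
by rewrite mevalD !mevalM addf_div.
Qed.

Lemma specM f g a b : spec f a -> spec g b -> spec (f * g) (a * b).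
Proof.
case=> N [M [h -> ->]] [N' [M' [h' -> ->]]]; exists (N * N'), (M * M').
split; first by rewrite mevalM mulf_neq0.
  by rewrite !rmorphM mulf_div.
by rewrite !mevalM mulf_div.
Qed.

Lemma specV f a : spec f a -> a != 0 -> spec f^-1 a^-1.
Proof.
case=> N [M [h -> ->]] nz.
have hN : N.@[P] != 0 by apply: contraNneq nz => ->; rewrite mul0r.
by exists M, N; split=> //; rewrite invf_div.
Qed.

Lemma specX f a j : spec f a -> spec (f ^+ j) (a ^+ j).
Proof.
move=> h; elim: j => [|j IH]; first by rewrite !expr0; apply: spec1.
by rewrite !exprS; apply: specM.
Qed.

Lemma spec_div f g a b : spec f a -> spec g b -> b != 0 -> spec (f / g) (a / b).
Proof. by move=> hf hg nz; apply: specM => //; apply: specV. Qed.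

(** The fractions need not be reduced; cross-multiplying in the polynomial ring shows that the value
    does not depend on the representative. *)
Lemma spec_uniq f a b : spec f a -> spec f b -> a = b.
Proof.
case=> N [M [h -> ->]] [N' [M' [h' E ->]]].
have {}E : N * M' = N' * M.
  apply/eqP; rewrite -tofrac_eq !rmorphM -eqr_div ?M0 //; exact/eqP.
by apply/eqP; rewrite eqr_div // -!mevalM E.
Qed.

Lemma spec_sum (I : finType) (A : pred I) (f : I -> K) (a : I -> k) :
  (forall i, A i -> spec (f i) (a i)) -> spec (\sum_(i | A i) f i) (\sum_(i | A i) a i).
Proof.
by move=> H; apply: (big_rec2 (fun x y => spec x y)) => [|i x y Ai]; [exact: spec0|apply: specD (H i Ai)].
Qed.

Lemma spec_prod_unit (I : finType) (A : pred I) (f : I -> K) :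
  (forall i, A i -> exists2 c, spec (f i) c & c != 0) ->
  exists2 c, spec (\prod_(i | A i) f i) c & c != 0.
Proof.
move=> H; apply: (big_ind (fun x => exists2 c, spec x c & c != 0)) => //.
- by exists 1; [exact: spec1|exact: oner_neq0].
- by move=> x y [a ha na] [b hb nb]; exists (a * b); [exact: specM|exact: mulf_neq0].
Qed.

End Specialisation.

(** * Zeros of quantum numbers, and nonvanishing for indeterminates *)

Section NonVanishing.
Variables (F : fieldType) (q : F).
Hypotheses (q0 : q != 0) (qq : q ^+ 2 != 1).

Lemma qbr_eq0 (X : F) : X != 0 -> (qbr q X == 0) = (X ^+ 2 == 1).
Proof.
move=> X0; rewrite /qbr mulf_eq0 invr_eq0 (negPf (qqV q0 qq)) orbF subr_eq0.
by rewrite -(inj_eq (mulfI X0)) mulfV // expr2.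
Qed.

Lemma qint_neq0 j : q ^+ (j * 2) != 1 -> qint q j != 0.
Proof. by move=> h; rewrite qbr_eq0 ?expf_neq0 // -exprM. Qed.

Lemma qdown_neq0 (Q : F) j : Q != 0 -> Q ^+ 2 != q ^+ (j * 2) -> qdown q Q j != 0.
Proof.
move=> Q0 h; rewrite qbr_eq0 ?mulf_neq0 ?invr_neq0 ?expf_neq0 //.
apply: contraNneq h; rewrite exprMn exprVn -exprM => e.
by rewrite -[X in _ == X]mul1r -e divfK // expf_neq0.
Qed.

End NonVanishing.

Section Generic.
Variable k : fieldType.
Local Notation K := {fraction {mpoly k[3]}}.
Local Notation qK := (qF k).
Local Notation Q1K := (Q1F k).
Local Notation Q2K := (Q2F k).

(** Powers of two variables are separated by a point where one variable is [0] and the other is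
    [1]. *)
Lemma monomial_neq (P : 'I_3 -> k) (i j : 'I_3) a b : P i = 0 -> P j = 1 ->
  FracField.tofrac ('X_i : {mpoly k[3]}) ^+ a.+1 !=
  FracField.tofrac ('X_j : {mpoly k[3]}) ^+ b.
Proof.
move=> Pi Pj; rewrite -!rmorphXn tofrac_eq; apply/eqP => /(congr1 (meval P)).
rewrite !rmorphXn /= !mevalXU Pi Pj expr1n expr0n /= => /eqP.
by rewrite eq_sym oner_eq0.
Qed.

Lemma var_neq0 (i : 'I_3) : FracField.tofrac ('X_i : {mpoly k[3]}) != 0.
Proof.
rewrite tofrac_eq0; apply/eqP => /(congr1 (meval (fun=> 1))).
by rewrite mevalXU meval0 => /eqP; rewrite oner_eq0.
Qed.

Lemma qK_root j : (0 < j)%N -> qK ^+ j != 1.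
Proof.
case: j => // j _; have := @monomial_neq (fun i => if i == 0 then 0 else 1) 0 1 j 0.
by rewrite expr0; apply.
Qed.

Lemma qK_qq : qK ^+ 2 != 1. Proof. exact: qK_root. Qed.

Lemma qintK_neq0 j : (0 < j)%N -> qint qK j != 0.
Proof.
move=> h; apply: (qint_neq0 (var_neq0 _) qK_qq).
by apply: qK_root; lia.
Qed.

Lemma qdownK_neq0 (i : 'I_3) j : i != 0 ->
  qdown qK (FracField.tofrac 'X_i) j != 0.
Proof.
move=> ni; apply: (qdown_neq0 (var_neq0 _) qK_qq (var_neq0 _)).
apply: (@monomial_neq (fun i' => if i' == i then 0 else 1) i 0 1).
  by rewrite eqxx.
by rewrite eq_sym (negPf ni).
Qed.

Lemma genericK n (sg : 'I_n -> K) : (forall x, sg x != 0) -> generic qK Q1K Q2K sg.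
Proof.
move=> h; split=> //; try exact: var_neq0.
- exact: qK_qq.
- exact: qintK_neq0.
- by move=> j; apply: qdownK_neq0.
- by move=> j; apply: qdownK_neq0.
Qed.

Definition prop_sign n l (x : 'I_n) : K := if (x %% (4 * l) < 2 * l)%N then 1 else -1.

Lemma prop_sign_neq0 n l (x : 'I_n) : prop_sign l x != 0.
Proof. by rewrite /prop_sign; case: ifP; rewrite ?oppr_eq0 oner_eq0. Qed.

(** The signs have period [4 * l] and change after half a period; this is all that is used of the
    sign rule. *)
Lemma prop_sign_shift n l (x y : 'I_n) : (0 < l)%N -> (y : nat) = (x + 2 * l)%N ->
  prop_sign l y = - prop_sign l x.
Proof.
move=> l0 e; rewrite /prop_sign e -modnDml.
have h : (x %% (4 * l) < 4 * l)%N by apply: ltn_pmod; lia.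
case: ltnP => h1; case: ltnP => h2; rewrite ?opprK //; exfalso; move: h1.
  by rewrite modn_small; lia.
have -> : (x %% (4 * l) + 2 * l = (x %% (4 * l) - 2 * l) + 4 * l)%N by lia.
by rewrite modnDr modn_small; lia.
Qed.

Lemma expz_opp (F : fieldType) (x : F) (m : nat) : x ^ (- m%:Z) = (x ^+ m)^-1.
Proof. by rewrite -invr_expz. Qed.

Lemma qnumE m : qnum k m%:Z = qint qK m.
Proof. by rewrite /qnum /qint /qbr expz_opp. Qed.

Lemma qnumwE (Q : K) m : qnumw Q (- (m%:Z)) = qdown qK Q m.
Proof.
by rewrite /qnumw /qdown /qbr opprK !expz_opp invfM invrK.
Qed.

Lemma hook_lineE n l (d : HD n) x :
  hook_line k l d x = hook qK Q1K Q2K (prop_sign l (n := n)) d x.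
Proof.
rewrite /hook_line /hook; case: (d x) => [[y b]|] //.
by case: ifP => // _; case: b => [[]|]; rewrite ?qnumE ?qnumwE.
Qed.

Definition hook_const l : K := qfact k l * qfactw Q1K l * qfactw Q2K l.

Lemma hook3E n l (d : HD n) :
  hook3 k l d = hook_const l * weight qK Q1K Q2K (prop_sign l (n := n)) d.
Proof.
by rewrite /hook3 /weight; congr (_ * _^-1); apply: eq_bigr => x _; rewrite hook_lineE.
Qed.

End Generic.

(** * Arcs whose hook contains the vanishing factor *)

Section Singular.
Variables (n l : nat).
Hypothesis hn : (2 * l < n)%N.
Implicit Types (d : HD n) (x y z p : 'I_n).

Lemma card_segment i j : (i <= j <= n)%N ->
  #|[set p : 'I_n | (i <= p < j)%N]| = (j - i)%N.
Proof.
elim: j => [|j IH] hij.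
  by rewrite (_ : [set p : 'I_n | _] = set0) ?cards0 //; apply/setP => p; rewrite !inE; lia.
have [e|h] : i = j.+1 \/ (i <= j)%N by lia.
  rewrite (_ : [set p : 'I_n | _] = set0) ?cards0 ?e ?subnn //.
  by apply/setP => p; rewrite !inE; lia.
have hj : (j < n)%N by lia.
rewrite (_ : [set p : 'I_n | _] = Ordinal hj |: [set p : 'I_n | (i <= p < j)%N]).
  by rewrite cardsU1 IH ?inE /=; lia.
by apply/setP => p; rewrite !inE -val_eqE /=; lia.
Qed.

Lemma card_arcs d : valid l d -> #|[set x | d x != None]| = (2 * l)%N.
Proof.
move=> /validP[_ hd]; have := cardsC [set x | d x == None].
rewrite -/(nprop d) hd card_ord (_ : ~: _ = [set x | d x != None]); first by lia.
by apply/setP => x; rewrite !inE.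
Qed.

Lemma segment_le d i j : valid l d -> (i <= j <= n)%N ->
  (forall x, (i <= x < j)%N -> d x <> None) -> (j - i <= 2 * l)%N.
Proof.
move=> vd hij H; rewrite -(card_arcs vd) -(card_segment hij).
by apply/subset_leq_card/subsetP => x; rewrite !inE => /H/eqP.
Qed.

Lemma segment_full d i j : valid l d -> (i <= j <= n)%N -> (j - i = 2 * l)%N ->
  (forall x, (i <= x < j)%N -> d x <> None) ->
  forall x, (i <= x < j)%N = (d x != None).
Proof.
move=> vd hij e H x.
have /setP/(_ x) : [set p : 'I_n | (i <= p < j)%N] = [set x | d x != None].
  apply/eqP; rewrite eqEcard (card_arcs vd) card_segment // e leqnn andbT.
  by apply/subsetP => y; rewrite !inE => /H/eqP.
by rewrite !inE.
Qed.

Definition hook_index (x y : nat) (b : blob) : nat :=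
  match b with
  | None => ((y - x).+1)./2
  | Some true => (y.+1)./2
  | Some false => ((n - x.+1).+1)./2
  end.

(* A line is singular when its hook contains the vanishing factor [l]. *)
Definition singular d x : bool :=
  if d x is Some (y, b) then (x < y)%N && (hook_index x y b == l) else false.

(** The ends of the segment that the arc forces to be free of propagating lines: beneath the arc,
    extended to the edge of its blob. Its length is twice [hook_index]. *)
Definition first_vertex (x y : nat) (b : blob) : nat :=
  match b with Some true => 0 | _ => x end.
Definition end_vertex (x y : nat) (b : blob) : nat :=
  match b with Some false => n | _ => y.+1 end.

Lemma arc_segment d x y b : diagram d -> d x = Some (y, b) -> (x < y)%N ->
  forall p, (first_vertex x y b <= p < end_vertex x y b)%N -> d p <> None.
Proof.
move=> dg E hxy p; have E' := (diag_sym dg E).2.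
have inner : (x <= p <= y)%N -> d p <> None.
  move=> h; have [/val_inj->|[/val_inj->|h']] : (p : nat) = x \/ (p : nat) = y \/ (x < p < y)%N by lia.
  - by rewrite E.
  - by rewrite E'.
  - by apply: (diag_np dg E); lia.
case: b E E' => [[]|] E E' /=; last by move=> h; apply: inner; lia.
  have [h _|h h'] := ltnP p x; first exact: diag_edge E h.
  by apply: inner; lia.
have [h _|h h'] := ltnP y p; first exact: diag_edge E' h.
by apply: inner; lia.
Qed.

(** The forced segment consists of arc ends, of which there are only [2 * l]. *)
Lemma hook_index_le d x y b : valid l d -> d x = Some (y, b) -> (x < y)%N ->
  (0 < hook_index x y b <= l)%N.
Proof.
move=> vd E h; have [dg _] := validP _ _ vd.
have hx := ltn_ord x; have hy := ltn_ord y.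
have := segment_le vd _ (arc_segment dg E h).
by case: b E => [[]|] E /=; lia.
Qed.

Lemma singular_segment d x : valid l d -> singular d x ->
  exists y b s, [/\ d x = Some (y, b), (x < y)%N,
    forall p, (s <= p < s + 2 * l)%N = (d p != None) &
    [/\ b <> Some true -> x = s :> nat, b <> Some false -> y.+1 = (s + 2 * l)%N,
        b = Some true -> s = 0%N & b = Some false -> (s + 2 * l)%N = n]].
Proof.
move=> vd; rewrite /singular; case E: (d x) => [[y b]|] // /andP[h /eqP hi].
have [dg _] := validP _ _ vd; have hx := ltn_ord x; have hy := ltn_ord y.
have seg := arc_segment dg E h.
have le := segment_le vd _ seg; have full := segment_full vd _ _ seg.
exists y, b, (first_vertex x y b).
have e : end_vertex x y b = (first_vertex x y b + 2 * l)%N.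
  by case: b {E seg full} hi le => [[]|] /=; lia.
split=> //.
  by rewrite -e; apply: full; [case: (b) e => [[]|] /=; lia|lia].
by case: b {E seg le full hi} e => [[]|] /= e; split=> // _; lia.
Qed.

(** Both forced segments equal the set of all arc ends, hence coincide. The two lines then share an
    end, unless one has a left and the other a right blob; in that case the segment would reach both
    edges, against [2 * l < n]. *)
Lemma singular_uniq d x x' : valid l d -> singular d x -> singular d x' -> x = x'.
Proof.
move=> vd /(singular_segment vd)[y [b [s [E hxy H [h1 h2 h3 h4]]]]].
move=> /(singular_segment vd)[y' [b' [s' [E' hxy' H' [h1' h2' h3' h4']]]]].
have hx := ltn_ord x; have hx' := ltn_ord x'.
have ss : s = s' \/ l = 0%N.
  have := H x; have := H' x; rewrite E /= => k1 k2.
  have := H x'; have := H' x'; rewrite E' /= => k3 k4.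
  have [lt|[lt|//]] : (s < s')%N \/ (s' < s)%N \/ s = s' \/ l = 0%N by lia.
  - by have hs : (s < n)%N; [lia|have := H (Ordinal hs); have := H' (Ordinal hs); rewrite /=; lia].
  - by have hs : (s' < n)%N; [lia|have := H (Ordinal hs); have := H' (Ordinal hs); rewrite /=; lia].
have [dg _] := validP _ _ vd.
case: ss => [ss|l0]; last by have := H x; rewrite E l0 /=; lia.
have sx : (x : nat) = x' -> x = x' by move/val_inj.
have sy : (y : nat) = y' -> x = x'.
  by move/val_inj => e; rewrite -e in E'; apply: (diag_inj dg E E').
case: b E h1 h2 h3 h4 => [[]|] E h1 h2 h3 h4;
case: b' E' h1' h2' h3' h4' => [[]|] E' h1' h2' h3' h4'.
all: try (by apply: sy; have := h2 ltac:(done); have := h2' ltac:(done); lia).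
all: try (by apply: sx; have := h1 ltac:(done); have := h1' ltac:(done); lia).
- by have := h3 erefl; have := h4' erefl; lia.
- by have := h4 erefl; have := h3' erefl; lia.
Qed.

Section Cup.
Variables (d : HD n) (u v : 'I_n).
Hypotheses (vd : valid l d) (huv : v = u.+1 :> nat) (Eu : d u = Some (v, None)).
Hypothesis hl : (1 < l)%N.

Let dg : diagram d. Proof. by case/validP: vd. Qed.
Let Ev : d v = Some (u, None). Proof. exact: (diag_sym dg Eu).2. Qed.

Lemma right_prop_le p b : right_prop d v p b -> (b.+1 <= l)%N.
Proof.
case=> hp Ep cl; have hpn := ltn_ord p.
have := @segment_le d u p vd; rewrite hp => H.
suff : ((v + 2 * b).+1 - u <= 2 * l)%N by lia.
apply: H; first by lia.
move=> x hx; have [/val_inj->|[/val_inj->|h]] : (x : nat) = u \/ (x : nat) = v \/ (v < x < p)%N by lia.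
- by rewrite Eu.
- by rewrite Ev.
- by have [x' ->] := cl x h.
Qed.

Lemma left_prop_le p a : left_prop d u p a -> (a.+1 <= l)%N.
Proof.
case=> hp Ep cl; have hvn := ltn_ord v.
suff : (v.+1 - p.+1 <= 2 * l)%N by lia.
apply: (segment_le vd); first by lia.
move=> x hx; have [/val_inj->|[/val_inj->|h]] : (x : nat) = u \/ (x : nat) = v \/ (p < x < u)%N by lia.
- by rewrite Eu.
- by rewrite Ev.
- by have [x' ->] := cl x h.
Qed.

(** A singular line would make the arcs fill [2 * l] consecutive vertices, and [p] would follow that
    segment immediately. The line would then end just before [p], in the cup or in the closed
    window, too short to reach the start of the segment; a right blob would need the segment to end
    at [n], beyond [p]. *)
Lemma right_prop_regular p b : right_prop d v p b -> forall x, ~~ singular d x.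
Proof.
case=> hp Ep cl x; apply/negP => /(singular_segment vd).
move=> [y [b' [s [E hxy H [h1 h2 h3 h4]]]]].
have hpn := ltn_ord p; have hu := H u; rewrite Eu /= in hu.
have hpH := H p; rewrite Ep /= in hpH.
have ps : (p : nat) = (s + 2 * l)%N.
  have [//|lt] : (p : nat) = (s + 2 * l)%N \/ (s + 2 * l < p)%N by lia.
  have hs : (s + 2 * l < n)%N by lia.
  have := H (Ordinal hs); rewrite /=.
  have hvH := H v; rewrite Ev /= in hvH.
  by have [|x' ->] := cl (Ordinal hs); rewrite /=; lia.
have E' := (diag_sym dg E).2.
have yp : b' <> Some false -> (y : nat) = v \/ (v < y < p)%N.
  by move=> /h2; lia.
case: b' E E' h1 h2 h3 h4 yp => [[]|] E E' h1 h2 h3 h4 yp; last first.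
- have [/val_inj e|h] := yp ltac:(done).
    (* The cup itself would be the singular line, forcing [l = 1]. *)
    rewrite e Ev in E'; case: E' => e'; have := h1 ltac:(done); have := h2 ltac:(done).
    by rewrite -e' e; lia.
  have [x' E'' h'] := cl y h; rewrite E' in E''; case: E'' h' => <- h'.
  by have := h1 ltac:(done); lia.
- by have := h4 erefl; lia.
- have [/val_inj e|h] := yp ltac:(done).
    by rewrite e Ev in E'.
  by have [x' E''] := cl y h; rewrite E' in E''.
Qed.

Lemma left_prop_regular p a : left_prop d u p a -> forall x, ~~ singular d x.
Proof.
case=> hp Ep cl x; apply/negP => /(singular_segment vd).
move=> [y [b' [s [E hxy H [h1 h2 h3 h4]]]]].
have hpn := ltn_ord p; have hv := H v; rewrite Ev /= in hv.
have hpH := H p; rewrite Ep /= in hpH.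
have ps : p.+1 = s.
  have [//|lt] : p.+1 = s \/ (p.+1 < s)%N by lia.
  have hun := ltn_ord u; have hs : (s.-1 < n)%N by lia.
  have := H (Ordinal hs); rewrite /=.
  have huH := H u; rewrite Eu /= in huH.
  by have [|x' ->] := cl (Ordinal hs); rewrite /=; lia.
have xp : b' <> Some true -> (x : nat) = u \/ (p < x < u)%N.
  by move=> /h1; lia.
case: b' E h1 h2 h3 h4 xp => [[]|] E h1 h2 h3 h4 xp; last first.
- have [/val_inj e|h] := xp ltac:(done).
    rewrite e Eu in E; case: E => e'; have := h1 ltac:(done); have := h2 ltac:(done).
    by rewrite -e' e; lia.
  have [x' E'' h'] := cl x h; rewrite E in E''; case: E'' h' => <- h'.
  by have := h2 ltac:(done); lia.
- have [/val_inj e|h] := xp ltac:(done).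
    by rewrite e Eu in E.
  by have [x' E''] := cl x h; rewrite E in E''.
- by have := h3 erefl; lia.
Qed.

End Cup.

Hypothesis hl : (0 < l)%N.

Let nest_lt x : (2 * l - x.+1 < n)%N. Proof. lia. Qed.

(** Concentric arcs at the left end: the outermost one has hook [[l]], which makes this diagram a
    witness of nonvanishing. *)
Definition nested : HD n :=
  [ffun x : 'I_n => if (x < 2 * l)%N then Some (Ordinal (nest_lt x), None) else None].

Lemma nested_some x y b : nested x = Some (y, b) ->
  [/\ (x < 2 * l)%N, b = None & y = (2 * l - x.+1)%N :> nat].
Proof. by rewrite ffunE; case: ifP => // h [<- <-]. Qed.

Lemma nested_valid : valid l nested.
Proof.
apply/validP; split; first split.
- move=> x y b /nested_some[h -> hy]; split.
    by rewrite -val_eqE /=; lia.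
  rewrite ffunE; have -> : (y < 2 * l)%N by lia.
  by congr (Some (_, _)); apply: val_inj; rewrite /=; lia.
- by move=> x x' y y' b b' /nested_some[? _ ?] /nested_some[? _ ?]; lia.
- move=> x y b p /nested_some[? _ ?] h1 h2; rewrite ffunE.
  by have -> : (p < 2 * l)%N by lia.
- by move=> x y s p /nested_some[].
- by move=> x y s a c b /nested_some[].
rewrite /nprop -(card_segment (i := 2 * l) (j := n)); last by lia.
apply: eq_card => x; rewrite !inE ffunE.
by case: ltnP => h; rewrite ltn_ord ?andbT ?h //=; lia.
Qed.

Lemma nested_singular : exists x, singular nested x.
Proof.
have h0 : (0 < n)%N by lia.
exists (Ordinal h0); rewrite /singular ffunE /=.
have -> : (0 < 2 * l)%N by lia.
by rewrite /hook_index /=; lia.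
Qed.

End Singular.

(** * Relating the actions over rational functions and over [k] *)

Section ActionTransfer.
Variables (F1 F2 : fieldType) (R : F1 -> F2 -> Prop).
Hypothesis R1 : R 1 1.
Variables (a0 aL aR b0L b0R : F1) (a0' aL' aR' b0L' b0R' : F2).
Hypotheses (r0 : R a0 a0') (rL : R aL aL') (rR : R aR aR').
Hypotheses (sL : R b0L b0L') (sR : R b0R b0R').
Variable n : nat.

Definition res_rel (x : option (F1 * HD n)) (y : option (F2 * HD n)) : Prop :=
  match x, y with
  | Some (c, D), Some (c', D') => D = D' /\ R c c'
  | None, None => True
  | _, _ => False
  end.

Lemma act_cup_rel (u v : 'I_n) D : res_rel (act_cup a0 aL aR b0L b0R u v D)
  (act_cup a0' aL' aR' b0L' b0R' u v D).
Proof.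
rewrite /act_cup; case: (D u) => [[y b]|]; case: (D v) => [[z b']|] //=.
- case: ifP => _ /=; first by split=> //; case: b => [[]|].
  by case: b b' => [[]|] [[]|].
- case: ifP => _ /=; first by split=> //; case: b => [[]|].
  by case: b.
- by case: b'.
Qed.

Lemma act_blob_rel s (p : 'I_n) D :
  res_rel (act_blob aL aR s p D) (act_blob aL' aR' s p D).
Proof.
rewrite /act_blob; case: (D p) => [[y [s'|]]|] //=.
by case: ifP => _ //=; split=> //; case: s.
Qed.

End ActionTransfer.

(** * Values at the root of unity *)

Section Evaluation.
Variables (k : fieldType) (l n : nat) (q Q1 Q2 : k).
Hypothesis hq : (2 * l).-primitive_root q.
Hypothesis hl : (1 < l)%N.
Hypothesis hn : (2 * l < n)%N.
Hypothesis hQ1 : Q1 != 0 /\ forall z : int, Q1 != q ^ z /\ Q1 != - q ^ z.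
Hypothesis hQ2 : Q2 != 0 /\ forall z : int, Q2 != q ^ z /\ Q2 != - q ^ z.

Local Notation K := {fraction {mpoly k[3]}}.
Local Notation P := (point3 q Q1 Q2).
Local Notation spec h c := (spec_at h P c).
Local Notation qK := (qF k).
Local Notation Q1K := (Q1F k).
Local Notation Q2K := (Q2F k).
Local Notation sgK := (@prop_sign k n l).
Local Notation wt := (weight qK Q1K Q2K sgK).
Local Notation hk := (hook qK Q1K Q2K sgK).
Local Notation unit f := (exists2 c, spec f c & c != 0).
Implicit Types (d D : HD n) (x y u v p : 'I_n).

Lemma root_neq0 : q != 0.
Proof.
apply/eqP => e; have := prim_expr_order hq.
have -> : (2 * l = (2 * l).-1.+1)%N by lia.
by rewrite e expr0n => /eqP; rewrite eq_sym oner_eq0.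
Qed.

Lemma root_expr_neq1 j : (0 < j < 2 * l)%N -> q ^+ j != 1.
Proof.
move=> /andP[h1 h2]; rewrite -(prim_order_dvd hq); apply/negP => /dvdn_leq; lia.
Qed.

Lemma root_sqr_neq1 : q ^+ 2 != 1.
Proof. by apply: root_expr_neq1; lia. Qed.

Local Notation q0 := root_neq0.
Local Notation qq := root_sqr_neq1.

Lemma root_half : q ^+ l = -1.
Proof.
have : (q ^+ l) ^+ 2 == 1 by rewrite -exprM mulnC (prim_expr_order hq).
rewrite sqrf_eq1 => /orP[|/eqP //]; rewrite (negPf (root_expr_neq1 _)) //; lia.
Qed.

Lemma qint_root_neq0 j : (0 < j < l)%N -> qint q j != 0.
Proof. by move=> h; apply: (qint_neq0 q0 qq); apply: root_expr_neq1; lia. Qed.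

Lemma qint_root_l : qint q l = 0.
Proof. by rewrite /qint /qbr root_half invrN invr1 subrr mul0r. Qed.

Lemma qint_root_pred : qint q l.-1 = 1.
Proof.
have e : q ^+ l.-1 = - q^-1.
  apply: (mulfI q0); rewrite -exprS prednK ?root_half; last by lia.
  by rewrite mulrN mulfV ?q0.
by rewrite /qint /qbr e invrN invrK opprK addrC mulfV // (qqV q0 qq).
Qed.

Lemma qdown_root_neq0 (Q : k) j : Q != 0 ->
  (forall z : int, Q != q ^ z /\ Q != - q ^ z) -> qdown q Q j != 0.
Proof.
move=> Q0 H; apply: (qdown_neq0 q0 qq Q0); have [h1 h2] := H j%:Z.
by rewrite exprM eqf_sqr negb_or; apply/andP.
Qed.

Lemma spec_q : spec qK q.
Proof. by have := spec_poly P 'X_0; rewrite mevalXU. Qed.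

Lemma spec_Q1 : spec Q1K Q1.
Proof. by have := spec_poly P 'X_1; rewrite mevalXU. Qed.

Lemma spec_Q2 : spec Q2K Q2.
Proof. by have := spec_poly P 'X_2; rewrite mevalXU. Qed.

Lemma spec_sub (f g : K) a b : spec f a -> spec g b -> spec (f - g) (a - b).
Proof. by move=> hf hg; apply: specD hf (specN hg). Qed.

Lemma spec_qbr (f : K) a : spec f a -> a != 0 -> spec (qbr qK f) (qbr q a).
Proof.
move=> hf a0; apply: spec_div; last exact: (qqV q0 qq).
  by apply: (spec_sub hf); apply: specV.
by apply: (spec_sub spec_q); apply: (specV spec_q); apply: q0.
Qed.

Lemma spec_qint j : spec (qint qK j) (qint q j).
Proof. by apply: spec_qbr; [apply: (specX _ spec_q)|apply: expf_neq0; apply: q0]. Qed.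

Lemma spec_qdown (f : K) (Q : k) j : spec f Q -> Q != 0 ->
  spec (qdown qK f j) (qdown q Q j).
Proof.
move=> hf Q0; have qj : q ^+ j != 0 by apply: expf_neq0; apply: q0.
apply: spec_qbr; last by rewrite mulf_neq0 // invr_eq0.
by apply: (spec_div hf) => //; apply: (specX _ spec_q).
Qed.

Lemma spec_up (f : K) (Q : k) : spec f Q -> Q != 0 ->
  spec (qbr qK (f * qK)) (qbr q (Q * q)).
Proof.
move=> hf Q0; apply: spec_qbr; first exact: (specM hf spec_q).
by apply: mulf_neq0 => //; apply: q0.
Qed.

Lemma unit1 : unit 1.
Proof. by exists 1; [apply: spec1|apply: oner_neq0]. Qed.

Lemma unitM (f g : K) : unit f -> unit g -> unit (f * g).
Proof. by move=> [a ha na] [b hb nb]; exists (a * b); [apply: specM|apply: mulf_neq0]. Qed.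

Lemma unitV (f : K) : unit f -> unit f^-1.
Proof. by move=> [a ha na]; exists a^-1; [apply: specV|rewrite invr_eq0]. Qed.

Lemma unit_qint j : (0 < j < l)%N -> unit (qint qK j).
Proof. by move=> h; exists (qint q j); [apply: spec_qint|apply: qint_root_neq0]. Qed.

Lemma unit_qdown1 j : unit (qdown qK Q1K j).
Proof.
case: hQ1 => Q0 H; exists (qdown q Q1 j); last exact: qdown_root_neq0.
exact: (spec_qdown _ spec_Q1).
Qed.

Lemma unit_qdown2 j : unit (qdown qK Q2K j).
Proof.
case: hQ2 => Q0 H; exists (qdown q Q2 j); last exact: qdown_root_neq0.
exact: (spec_qdown _ spec_Q2).
Qed.

Lemma spec_sign x : exists2 s : k, spec (sgK x) s & s != 0.
Proof.
rewrite /prop_sign; case: ifP => _; first exact: unit1.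
exists (-1); first exact: (specN (spec1 P)).
by rewrite oppr_eq0 oner_neq0.
Qed.

Lemma hook_unit d x : valid l d -> ~~ singular l d x -> unit (hk d x).
Proof.
move=> vd; rewrite /singular /hook; case E: (d x) => [[y b]|]; last first.
  by move=> _; apply: spec_sign.
case: ifP => [h /= ns|_ _]; last exact: unit1.
have hi := hook_index_le hn vd E h.
have {ns}hi : (0 < hook_index n x y b < l)%N by move: ns hi; lia.
case: b {E} hi => [[]|] hi; rewrite /arc_hook.
- by apply: unitM; [apply: unit_qint|apply: unit_qdown1].
- by apply: unitM; [apply: unit_qint|apply: unit_qdown2].
- exact: unit_qint.
Qed.

Lemma hook_singular d x : singular l d x ->
  exists2 g : K, unit g & hk d x = qint qK l * g.
Proof.
rewrite /singular /hook; case: (d x) => [[y b]|] // /andP[-> /eqP].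
case: b => [[]|]; rewrite /hook_index /arc_hook => ->.
- by exists (qdown qK Q1K x./2) => //; apply: unit_qdown1.
- by exists (qdown qK Q2K (n - y.+1)./2) => //; apply: unit_qdown2.
- by exists 1; [apply: unit1|rewrite mulr1].
Qed.

Lemma weight_regular d : valid l d -> (forall x, ~~ singular l d x) -> unit (wt d).
Proof.
move=> vd H; apply: unitV; apply: spec_prod_unit => x _; exact: hook_unit.
Qed.

Lemma cancel_factor (F : fieldType) (a g r : F) : a != 0 ->
  a * (a * g * r)^-1 = (g * r)^-1.
Proof. by move=> a0; rewrite -mulrA invfM mulrA mulfV // mul1r. Qed.

(** By [singular_uniq] exactly one hook has the factor [[l]], so the pole of the weight is cancelled
    by one such factor. *)
Lemma weight_singular d x : valid l d -> singular l d x -> unit (qint qK l * wt d).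
Proof.
move=> vd sx; have [g ug e] := hook_singular sx.
rewrite /weight (bigD1 x) //= e cancel_factor; last by apply: qintK_neq0; lia.
apply: unitV; apply: unitM => //; apply: spec_prod_unit => x' /eqP nx.
apply: hook_unit => //; apply/negP => sx'; apply: nx.
exact: (singular_uniq hn vd sx' sx).
Qed.

Definition reduced_const : K := qfact k l.-1 * qfactw Q1K l * qfactw Q2K l.

Lemma hook_constE : hook_const k l = reduced_const * qint qK l.
Proof.
have -> : hook_const k l = qfact k l.-1.+1 * qfactw Q1K l * qfactw Q2K l.
  by rewrite prednK //; lia.
rewrite {1}/qfact big_ord_recr /= -/(qfact k l.-1) qnumE prednK; last by lia.
rewrite /reduced_const; move: (qfact k l.-1) (qfactw Q1K l) (qfactw Q2K l) (qint qK l).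
by move=> a b c e; rewrite -!mulrA; congr (_ * _); rewrite mulrCA; congr (_ * _); rewrite mulrC.
Qed.

Lemma unit_reduced_const : unit reduced_const.
Proof.
apply: unitM; first apply: unitM; apply: spec_prod_unit => j _.
- by rewrite qnumE; apply: unit_qint; have := ltn_ord j; lia.
- by rewrite qnumwE; apply: unit_qdown1.
- by rewrite qnumwE; apply: unit_qdown2.
Qed.

Lemma spec_hook_const0 : spec (hook_const k l) 0.
Proof.
rewrite hook_constE; have [c hc _] := unit_reduced_const.
by have := specM hc (spec_qint l); rewrite qint_root_l mulr0.
Qed.

(** The numerator contains [[l]] once: it cancels the pole of a diagram with a singular line, and
    makes the value [0] for the others. *)
Lemma hook3_regular d : valid l d -> exists c, spec (hook3 k l d) c.
Proof.
move=> vd; rewrite hook3E.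
have [/existsP[x sx]|/existsPn ns] := boolP [exists x, singular l d x].
  have [c hc _] := weight_singular vd sx; have [c' hc' _] := unit_reduced_const.
  by rewrite hook_constE -mulrA; exists (c' * c); apply: specM.
have [c hc _] := weight_regular vd ns.
by exists (0 * c); apply: specM hc; apply: spec_hook_const0.
Qed.

Lemma hook3_nested c : spec (hook3 k l (nested hn (ltnW hl))) c -> c != 0.
Proof.
have [x sx] := nested_singular hn (ltnW hl).
have U : unit (hook3 k l (nested hn (ltnW hl))).
  rewrite hook3E hook_constE -mulrA; apply: unitM; first exact: unit_reduced_const.
  exact: (weight_singular (nested_valid hn (ltnW hl)) sx).
by move=> hc; case: U => c' hc' nc'; rewrite (spec_uniq hc hc').
Qed.

Lemma spec_zero (f g : K) c : spec f 0 -> spec g c -> spec (f * g) 0.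
Proof. by move=> hf hg; have := specM hf hg; rewrite mul0r. Qed.

Lemma spec_weight0 d : valid l d -> (forall x, ~~ singular l d x) ->
  spec (hook_const k l * wt d) 0.
Proof.
by move=> vd ns; have [c hc _] := weight_regular vd ns; apply: (spec_zero spec_hook_const0 hc).
Qed.

Lemma regroup (F : fieldType) (c a w s : F) : a != 0 -> c * a * w * (s / a) = s * (c * w).
Proof. by move=> a0; field; rewrite a0. Qed.

Lemma div_opp (F : fieldType) (s t : F) : s != 0 -> t = - s -> s / t = -1.
Proof. by move=> s0 ->; rewrite invrN mulrN mulfV. Qed.

Lemma opp_div (F : fieldType) (s t : F) : t != 0 -> s = - t -> s / t = -1.
Proof. by move=> t0 ->; rewrite mulNr mulfV. Qed.

(** If [a.+1 < l], the quotient is regular and the factor [[l]] of [hook_const] gives [0]. If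
    [a.+1 = l], the denominator uses up that factor, but then [x] and [y] are half a sign period
    apart and the numerator becomes [[l-1] - 1 = 0]. *)
Lemma spec_prop_end d (x y : 'I_n) a : valid l d -> (forall z, ~~ singular l d z) ->
  (a.+1 <= l)%N -> ((y : nat) = (x + 2 * a.+1)%N \/ (x : nat) = (y + 2 * a.+1)%N) ->
  spec (hook_const k l * wt d * ((qint qK a + sgK x / sgK y) / qint qK a.+1)) 0.
Proof.
move=> vd ns ha hxy.
have [sx hx _] := spec_sign x; have [sy hy ny] := spec_sign y.
have hs := specD (spec_qint a) (spec_div hx hy ny).
have [lt|e] : (a.+1 < l)%N \/ a.+1 = l by lia.
  apply: (spec_zero (spec_weight0 vd ns) (spec_div hs (spec_qint a.+1) _)).
  by apply: qint_root_neq0.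
have e' : a = l.-1 by lia.
have sgE : sgK x / sgK y = -1.
  have l0 : (0 < l)%N by lia.
  have ny0 := prop_sign_neq0 k l y; have nx0 := prop_sign_neq0 k l x.
  case: hxy; rewrite e => /(prop_sign_shift k l0) h.
    exact: (div_opp nx0 h).
  exact: (opp_div ny0 h).
have hz : spec (qint qK a + sgK x / sgK y) 0.
  rewrite sgE; have := specD (spec_qint a) (specN (spec1 P)).
  by rewrite [qint q a](_ : _ = 1) ?subrr // e' qint_root_pred.
rewrite e hook_constE regroup; last by apply: qintK_neq0; lia.
have [c hc _] := weight_regular vd ns; have [c' hc' _] := unit_reduced_const.
exact: (spec_zero hz (specM hc' hc)).
Qed.

Lemma cup_total_spec d u v t : valid l d -> v = u.+1 :> nat ->
  d u = Some (v, None) -> cup_total qK Q1K Q2K sgK d u v t ->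
  spec (hook_const k l * (wt d * t)) 0.
Proof.
move=> vd huv Eu; rewrite mulrA; case.
- by rewrite mulr0; apply: spec0.
- move=> p a p' b Lp Rp _.
  have ns := right_prop_regular hn vd huv Eu hl Rp.
  have h1 := spec_zero (spec_weight0 vd ns) (specN (spec_qint 2)).
  have h2 := spec_prop_end (x := p) (y := v) vd ns (left_prop_le hn vd huv Eu hl Lp).
  have h3 := spec_prop_end (x := p') (y := u) vd ns (right_prop_le hn vd huv Eu hl Rp).
  rewrite !mulrDr -[0]addr0 -[X in _ (X + 0)]addr0; apply: specD (specD h1 (h2 _)) (h3 _).
    by case: Lp => hp _ _; left; lia.
  by case: Rp => hp _ _; right; lia.
- move=> c p b Rp _; have ns := right_prop_regular hn vd huv Eu hl Rp.
  rewrite mulrDr -[0]addr0; apply: specD.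
    have [c1 h1 _] := unit_qdown1 c.+1; have [c2 h2 n2] := unit_qdown1 c.
    exact: (spec_zero (spec_weight0 vd ns) (specN (spec_div h1 h2 n2))).
  apply: spec_prop_end => //; first exact: (right_prop_le hn vd huv Eu hl Rp).
  by case: Rp => hp _ _; right; lia.
- move=> c p a Lp _; have ns := left_prop_regular hn vd huv Eu hl Lp.
  rewrite mulrDr -[0]addr0; apply: specD.
    have [c1 h1 _] := unit_qdown2 c.+1; have [c2 h2 n2] := unit_qdown2 c.
    exact: (spec_zero (spec_weight0 vd ns) (specN (spec_div h1 h2 n2))).
  apply: spec_prop_end => //; first exact: (left_prop_le hn vd huv Eu hl Lp).
  by case: Lp => hp _ _; left; lia.
Qed.

Lemma exists_prop d : valid l d -> exists p, d p = None.
Proof.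
move=> /validP[_ h]; have /card_gt0P[p] : (0 < #|[set x | d x == None]|)%N.
  by rewrite -/(nprop d) h; lia.
by rewrite inE => /eqP; exists p.
Qed.

Variable c : HD n -> k.
Hypothesis hc : forall D, valid l D -> spec (hook3 k l D) (c D).

Let gK : generic qK Q1K Q2K sgK.
Proof. by apply: genericK => x; apply: prop_sign_neq0. Qed.

(** One rational function is specialised twice: as a total it gives [0], and term by term, each term
    being an action constant times a regular hook value, it gives the sum over [k]. *)
Lemma cup_kills u v d : v = u.+1 :> nat -> valid l d ->
  \sum_(D | valid l D)
    (if act_cup (- qint q 2) (- qdown q Q1 0) (- qdown q Q2 0)
          (qbr q (Q1 * q)) (qbr q (Q2 * q)) u v D is Some (a, D'')
     then if D'' == d then a * c D else 0 else 0) = 0.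
Proof.
move=> huv vd; have nuv : (u : nat) <> v by lia.
have [/eqP Eu|ne] := boolP (d u == Some (v, None)); last first.
  apply: big1 => D /validP[dgD _]; case E: act_cup => [[a D']|] //.
  case: eqP => // e; rewrite e in E.
  by have [E' _] := act_cupP dgD nuv E; rewrite E' eqxx in ne.
have [p Ep] := exists_prop vd.
have [t Ht Hsum] := cup_sum gK vd huv Eu Ep.
have H0 := cup_total_spec vd huv Eu Ht; rewrite -Hsum mulr_sumr in H0.
apply: spec_uniq H0; apply: spec_sum => D vD; rewrite /cup_coef.
have [n1 _] := hQ1; have [n2 _] := hQ2.
have := act_cup_rel (R := fun f a => spec f a) (spec1 P)
  (specN (spec_qint 2)) (specN (spec_qdown 0 spec_Q1 n1))
  (specN (spec_qdown 0 spec_Q2 n2)) (spec_up spec_Q1 n1) (spec_up spec_Q2 n2) u v D.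
case: act_cup => [[a D1]|]; case: act_cup => [[a' D2]|] //=.
  move=> [-> ha]; case: eqP => _; last by rewrite mulr0; apply: spec0.
  by rewrite mulrCA; apply: specM => //; rewrite -hook3E; apply: hc.
by move=> _; rewrite mulr0; apply: spec0.
Qed.

Lemma blob_kills s p d : (p : nat) = (if s then 0 else n.-1)%N -> valid l d ->
  \sum_(D | valid l D)
    (if act_blob (- qdown q Q1 0) (- qdown q Q2 0) s p D is Some (a, D'')
     then if D'' == d then a * c D else 0 else 0) = 0.
Proof.
move=> hp vd; have Hsum := blob_sum gK vd hp.
have H0 : spec (hook_const k l * 0) 0 by rewrite mulr0; apply: spec0.
rewrite -Hsum mulr_sumr in H0.
apply: spec_uniq H0; apply: spec_sum => D vD; rewrite /blob_coef.
have [n1 _] := hQ1; have [n2 _] := hQ2.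
have := act_blob_rel (R := fun f a => spec f a) (spec1 P)
  (specN (spec_qdown 0 spec_Q1 n1)) (specN (spec_qdown 0 spec_Q2 n2)) s p D.
case: act_blob => [[a D1]|]; case: act_blob => [[a' D2]|] //=.
  move=> [-> ha]; case: eqP => _; last by rewrite mulr0; apply: spec0.
  by rewrite mulrCA; apply: specM => //; rewrite -hook3E; apply: hc.
by move=> _; rewrite mulr0; apply: spec0.
Qed.

End Evaluation.

(* k a field, q a primitive 2l-th root of unity, 2l < n, w1, w2 not integers
   (Q_i = q^{w_i} in k^x, Q_i not in +-q^Z).  xi : S_n(-n) -> S_n(-n+2l),
   E |-> sum_D h_3(D) D, is a nonzero b_n^x-module homomorphism.
   [c D] is the value of h_3(D) at (q,Q1,Q2) (which in particular exists). *)
Theorem theorem4p3p2 (k : fieldType) (l n : nat) (q Q1 Q2 : k)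
  (hq : (2 * l).-primitive_root q)
  (hl : (1 < l)%N)
  (hn : (2 * l < n)%N)
  (hQ1 : Q1 != 0 /\ forall z : int, Q1 != q ^ z /\ Q1 != - q ^ z)
  (hQ2 : Q2 != 0 /\ forall z : int, Q2 != q ^ z /\ Q2 != - q ^ z) :
  let qn (m : int) : k := (q ^ m - q ^ (- m)) / (q - q^-1) in
  let qnw (Q : k) (m : int) : k := (Q * q ^ m - Q^-1 * q ^ (- m)) / (q - q^-1) in
  let delta := - qn 2 in
  let deltaL := - qnw Q1 0 in
  let deltaR := - qnw Q2 0 in
  let kappaL := qnw Q1 1 in
  let kappaR := qnw Q2 1 in
  (* the action of the generators on S_n(-n+2l), on coordinate vectors *)
  let act := act_vec (n := n) (k := k) l in
  let ecup := act_cup (n := n) delta deltaL deltaR kappaL kappaR in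
  let eblob := act_blob (n := n) deltaL deltaR in
  exists c : HD n -> k,
    (* c D is the specialisation of the rational function h_3(D) *)
    (forall D : HD n, valid l D ->
       spec_at (hook3 k l D) (point3 q Q1 Q2) (c D)) /\
    (* xi(x E) = x * sum_D c D * D; the generators act on S_n(-n) by 0;
       xi commutes with e, with each e_i, and with f *)
    let xi (x : k) : HD n -> k := fun D => x * c D in
    let act0 (x : k) : k := 0 in
    [/\ forall (p : 'I_n) (x : k) (D' : HD n), val p = 0%N -> valid l D' ->
          xi (act0 x) D' = act (eblob true p) (xi x) D',
        forall (u v : 'I_n) (x : k) (D' : HD n), val v = (val u).+1 ->
          valid l D' ->
          xi (act0 x) D' = act (ecup u v) (xi x) D',
        forall (p : 'I_n) (x : k) (D' : HD n), val p = n.-1 -> valid l D' ->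
          xi (act0 x) D' = act (eblob false p) (xi x) D'
      & (* xi is non-zero *)
        exists D : HD n, valid l D && (c D != 0)].
Proof.
move=> qn qnw delta deltaL deltaR kappaL kappaR act ecup eblob.
have [c hc] : exists c : HD n -> k, forall D, valid l D ->
    spec_at (hook3 k l D) (point3 q Q1 Q2) (c D).
  (* Hook values are chosen on valid diagrams; elsewhere the default [0] is harmless, since the
     action sums over valid diagrams only. *)
  apply: (fin_all_exists (P := fun (D : HD n) a => valid l D ->
    spec_at (hook3 k l D) (point3 q Q1 Q2) a)) => D.
  have [vD|nv] := boolP (valid l D); last by exists 0.
  by have [a ha] := hook3_regular hq hl hn hQ1 hQ2 vD; exists a.
exists c; split=> // xi act0.
(* By linearity in [x], each commutation reduces to the vanishing of the coefficients for
   [x = 1]. *)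
have actE a x D' : act a (xi x) D' = x * \sum_(D | valid l D)
    (if a D is Some (e, D'') then if D'' == D' then e * c D else 0 else 0).
  rewrite mulr_sumr; apply: eq_bigr => D _; case: (a D) => [[e D'']|]; last by rewrite mulr0.
  by case: eqP => _; rewrite ?mulr0 // mulrCA.
have xi0 x D' : xi (act0 x) D' = 0 by rewrite /xi mul0r.
have e0 : delta = - qint q 2 by [].
have eD Q : qnw Q 0 = qdown q Q 0.
  by rewrite /qnw /qdown /qbr oppr0 !expr0z expr0 !mulr1 divr1.
have eU Q : qnw Q 1 = qbr q (Q * q).
  by rewrite /qnw /qbr expr1z invfM -exprnN expr1.
split.
- move=> p x D' hp vD'; rewrite xi0 actE /eblob /deltaL /deltaR !eD.
  by rewrite (blob_kills hq hl hn hQ1 hQ2 hc) ?mulr0.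
- move=> u v x D' huv vD'; rewrite xi0 actE /ecup e0 /deltaL /deltaR /kappaL /kappaR.
  by rewrite !eD !eU (cup_kills hq hl hn hQ1 hQ2 hc) ?mulr0.
- move=> p x D' hp vD'; rewrite xi0 actE /eblob /deltaL /deltaR !eD.
  by rewrite (blob_kills hq hl hn hQ1 hQ2 hc) ?mulr0.
- have vN := nested_valid hn (ltnW hl).
  exists (nested hn (ltnW hl)); rewrite vN /=.
  exact: (hook3_nested hq hQ1 hQ2 (hc _ vN)).
Qed.
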